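(* Let $\gamma=(\gamma_t)_{0\leqslant t\leqslant 1}$, $\gamma_t=(x_t,y_t)$, be a weakly geometric rough path over $\mathbb{R}^2$ satisfying $x_0=y_0=0$ and $x_1=1$. Suppose that $\log S(\gamma)$ has infinite radius of convergence. Then $$\int_0^1 e^{2k\pi i\cdot x_t}\,dy_t=0$$ for all nonzero integers $k$.
   Context: $T((V))=\prod_{n\geqslant 0}V^{\otimes n}$ is the algebra of formal tensor series with product $(\xi\otimes\eta)_n=\sum_{k=0}^n\xi_k\otimes\eta_{n-k}$. For $\xi$ with $\xi_0=1$, $\log\xi=\sum_{n\geqslant1}\frac{(-1)^{n-1}}{n}(\xi-\mathbf{1})^{\otimes n}$. Each $V^{\otimes n}$ carries the projective tensor norm. The radius of convergence of $\xi\in T((V))$ is that of the power series $\sum_{n\geqslant0}\|\xi_n\|z^n$. A $p$-rough path over $V$ ($p\geqslant1$) is a continuous map $\mathbf{X}=(1,X^1,\dots,X^{[p]})$ on $\{0\leqslant s\leqslant t\leqslant 1\}$ with values in the tensor algebra truncated at level $[p]$, such that $\mathbf{X}_{s,u}=\mathbf{X}_{s,t}\otimes\mathbf{X}_{t,u}$ and $\sum_{i=1}^{[p]}\sup_{\mathcal P}\sum_{t_l\in\mathcal P}\|X^i_{t_{l-1},t_l}\|^{p/i}<\infty$. It is weakly geometric if it takes values in the truncated group of group-like elements (exponentials of Lie polynomials). By Lyons' extension theorem it extends uniquely to a multiplicative functional $S(\mathbf{X})_{\cdot,\cdot}$ in $T((V))$ whose truncations have finite $p$-variation; $S(\mathbf{X})_{0,1}$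 is the signature and its logarithm the logarithmic signature. ''A rough path $\gamma$'' refers to the path $\gamma$ which is the first level component of a rough path $\mathbf{X}$, and $S(\gamma)=S(\mathbf{X})_{0,1}$. When $p=1$, $\gamma$ is a continuous path of bounded variation and $S(\gamma)$ is the sequence of its iterated Lebesgue-Stieltjes integrals $\int_{0<t_1<\cdots<t_n<1}d\gamma_{t_1}\otimes\cdots\otimes d\gamma_{t_n}$. Integrals along $\gamma$ are rough path integrals with respect to the underlying rough path (Lebesgue-Stieltjes integrals in the bounded variation case). *)

(* Defs.v *)
From HB Require Import structures.
From mathcomp Require Import all_boot all_order all_algebra.
From mathcomp Require Import all_classical all_reals all_analysis.
From mathcomp Require Export complex.

Set Implicit Arguments.
Unset Strict Implicit.
Unset Printing Implicit Defensive.

Import Order.TTheory GRing.Theory Num.Theory.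
Import numFieldNormedType.Exports.

Local Open Scope classical_set_scope.
Local Open Scope ring_scope.

(* Tensors over V = R^d are given by their coordinates in the standard basis:
   [w = [:: i_1; ...; i_n]] indexes e_(i_1) (x) ... (x) e_(i_n).  A tensor
   series is a function on all words; its component in the n-th tensor power of
   V is its restriction to the words of length n. *)
Definition tensor (R : realType) (d n : nat) := {ffun n.-tuple 'I_d -> R}.
Definition tseries (R : realType) (d : nat) := seq 'I_d -> R.

Definition tlevel (R : realType) (d : nat) (n : nat) (xi : tseries R d) :
  tensor R d n := [ffun w : n.-tuple 'I_d => xi w].

Definition ttrunc (R : realType) (d : nat) (N : nat) (xi : tseries R d) :
  tseries R d := fun w => if (size w <= N)%N then xi w else 0.

Definition tone (R : realType) (d : nat) : tseries R d :=
  fun w => (w == [::])%:R.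

Definition tvec (R : realType) (d : nat) (v : 'rV[R]_d) : tseries R d :=
  fun w => if w is [:: i] then v 0 i else 0.

Definition tadd (R : realType) (d : nat) (xi eta : tseries R d) : tseries R d :=
  fun w => xi w + eta w.

Definition tscale (R : realType) (d : nat) (c : R) (xi : tseries R d) :
  tseries R d := fun w => c * xi w.

Definition tsub (R : realType) (d : nat) (xi eta : tseries R d) : tseries R d :=
  fun w => xi w - eta w.

Definition tmul (R : realType) (d : nat) (xi eta : tseries R d) : tseries R d :=
  fun w => \sum_(k < (size w).+1) xi (take k w) * eta (drop k w).

Definition tpow (R : realType) (d : nat) (xi : tseries R d) (n : nat) :
  tseries R d := iter n (tmul xi) (@tone R d).

(* If [xi] has constant term 1, then (xi - 1)^n vanishes on the words of length
   less than n, so that only the terms n <= size w of the series contribute at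
   the word w.  The same truncation applies to [texp xi] when [xi] has constant
   term 0. *)
Definition tlog (R : realType) (d : nat) (xi : tseries R d) : tseries R d :=
  fun w => \sum_(1 <= n < (size w).+1)
    (-1) ^+ n.-1 / n%:R * tpow (tsub xi (@tone R d)) n w.

Definition texp (R : realType) (d : nat) (xi : tseries R d) : tseries R d :=
  fun w => \sum_(0 <= n < (size w).+1) (n`!%:R)^-1 * tpow xi n w.

Inductive lie_poly (R : realType) (d : nat) : tseries R d -> Prop :=
| LieVec (v : 'rV[R]_d) : lie_poly (tvec v)
| LieAdd (a b : tseries R d) : lie_poly a -> lie_poly b -> lie_poly (tadd a b)
| LieScale (c : R) (a : tseries R d) : lie_poly a -> lie_poly (tscale c a)
| LieBracket (a b : tseries R d) : lie_poly a -> lie_poly b ->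
    lie_poly (tsub (tmul a b) (tmul b a)).

Definition eucl_norm (R : realType) (d : nat) (v : 'rV[R]_d) : R :=
  Num.sqrt (\sum_i v 0 i ^+ 2).

Definition pure_tensor (R : realType) (d n : nat) (v : 'I_n -> 'rV[R]_d) :
  tensor R d n := [ffun w : n.-tuple 'I_d => \prod_(i < n) v i 0 (tnth w i)].

(* The scalar coefficients [t.1] only matter for n = 0, where the projective
   norm is the absolute value; for n > 0 they can be absorbed in a vector. *)
Definition proj_norm (R : realType) (d n : nat) (xi : tensor R d n) : R :=
  inf [set r : R | exists s : seq (R * ('I_n -> 'rV[R]_d)),
    (forall w, xi w = \sum_(t <- s) t.1 * pure_tensor t.2 w) /\
    r = \sum_(t <- s) `|t.1| * \prod_(i < n) eucl_norm (t.2 i)].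

Definition level_norm (R : realType) (d n : nat) (xi : tseries R d) : R :=
  proj_norm (tlevel n xi).

Definition radius_of_convergence (R : realType) (a : R^nat) : \bar R :=
  ereal_sup [set r%:E | r in
    [set r : R | 0 <= r /\ cvgn (series (fun n => a n * r ^+ n))]].

Definition tseries_radius (R : realType) (d : nat) (xi : tseries R d) : \bar R :=
  radius_of_convergence (fun n => level_norm n xi).

Definition simplex (R : realType) : set (R * R) :=
  [set st | [/\ 0 <= st.1, st.1 <= st.2 & st.2 <= 1]].

(* A partition 0 < t_1 < ... < t_m = 1 is the sequence [:: t_1; ...; t_m], as
   in [itv_partition]; its intervals are the pairs (t_(l-1), t_l), t_0 = 0. *)
Definition intervals (R : realType) (P : seq R) : seq (R * R) :=
  zip (0 :: P) P.

Definition level_pvar (R : realType) (d : nat) (p : R) (i : nat)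
    (X : R -> R -> tseries R d) : \bar R :=
  ereal_sup [set (\sum_(st <- intervals P)
                    level_norm i (X st.1 st.2) `^ (p / i%:R))%:E
            | P in [set P : seq R | itv_partition 0 1 P]].

Definition level_continuous (R : realType) (d : nat) (i : nat)
    (X : R -> R -> tseries R d) : Prop :=
  forall st : R * R, simplex st ->
    level_norm i (tsub (X uv.1 uv.2) (X st.1 st.2))
      @[uv --> within (@simplex R) (nbhs st)] --> (0 : R).

(* Continuous multiplicative functional of degree N with finite p-variation;
   only its values on the simplex are constrained. *)
Record mult_functional (R : realType) (d : nat) (p : R) (N : nat)
    (X : R -> R -> tseries R d) : Prop := MultFunctional {
  mf_trunc : forall s t, simplex (s, t) -> ttrunc N (X s t) = X s t;
  mf_one : forall s t, simplex (s, t) -> X s t [::] = 1;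
  mf_chen : forall s t u, 0 <= s -> s <= t -> t <= u -> u <= 1 ->
    X s u = ttrunc N (tmul (X s t) (X t u));
  mf_continuous : forall i, (1 <= i <= N)%N -> level_continuous i X;
  mf_pvar : (\sum_(1 <= i < N.+1) level_pvar p i X < +oo)%E }.

Definition rough_path (R : realType) (d : nat) (p : R)
    (X : R -> R -> tseries R d) : Prop :=
  1 <= p /\ mult_functional p (Num.truncn p) X.

Definition weakly_geometric (R : realType) (d : nat) (p : R)
    (X : R -> R -> tseries R d) : Prop :=
  forall s t, simplex (s, t) ->
    exists2 L, lie_poly L & X s t = ttrunc (Num.truncn p) (texp L).

Definition first_level_path (R : realType) (d : nat)
    (X : R -> R -> tseries R d) (gamma : R -> 'rV[R]_d) : Prop :=
  forall s t, simplex (s, t) ->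
    forall i, X s t [:: i] = gamma t 0 i - gamma s 0 i.

Definition lyons_extension (R : realType) (d : nat) (p : R)
    (X S : R -> R -> tseries R d) : Prop :=
  [/\ forall s t, simplex (s, t) -> ttrunc (Num.truncn p) (S s t) = X s t,
      forall s t u, 0 <= s -> s <= t -> t <= u -> u <= 1 ->
        S s u = tmul (S s t) (S t u)
    & forall n, mult_functional p n (fun s t => ttrunc n (S s t))].

(* By Lyons' extension theorem, a rough path has exactly one signature. *)
Definition is_signature (R : realType) (d : nat) (p : R)
    (X : R -> R -> tseries R d) (sigma : tseries R d) : Prop :=
  exists2 S, lyons_extension p X S & sigma = S 0 1.

Definition partial (R : realType) (d : nat) (i : 'I_d) (f : 'rV[R]_d -> R) :
  'rV[R]_d -> R := fun v => 'D_(delta_mx 0 i) f v.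

Definition partials (R : realType) (d : nat) (w : seq 'I_d)
    (f : 'rV[R]_d -> R) : 'rV[R]_d -> R := foldr (@partial R d) f w.

(* A smooth one-form alpha = sum_j alpha_j dx_j on R^d.  The local approximation
   of its rough integral over [s, t] is
     sum_(k < [p]) (D^k alpha)(gamma_s) (X^(k+1)_(s,t)),
   the first k tensor factors being fed to D^k and the last one to alpha. *)
Definition rough_germ (R : realType) (d : nat) (p : R)
    (X : R -> R -> tseries R d) (gamma : R -> 'rV[R]_d)
    (alpha : 'I_d -> 'rV[R]_d -> R) (s t : R) : R :=
  \sum_(k < Num.truncn p) \sum_(w : k.-tuple 'I_d) \sum_(j < d)
    partials w (alpha j) (gamma s) * X s t (rcons w j).

(* Limit along partitions of [0, 1] with mesh tending to 0.  For p < 2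
   the sums are Riemann-Stieltjes sums; in particular, for p = 1 the limit is
   the Lebesgue-Stieltjes integral. *)
Definition is_rough_integral (R : realType) (d : nat) (p : R)
    (X : R -> R -> tseries R d) (gamma : R -> 'rV[R]_d)
    (alpha : 'I_d -> 'rV[R]_d -> R) (I : R) : Prop :=
  forall eps : R, 0 < eps -> exists2 delta : R, 0 < delta &
    forall P : seq R, itv_partition 0 1 P ->
      (forall st, st \in intervals P -> st.2 - st.1 < delta) ->
      `|\sum_(st <- intervals P) rough_germ p X gamma alpha st.1 st.2 - I| < eps.

Definition is_rough_integralC (R : realType) (d : nat) (p : R)
    (X : R -> R -> tseries R d) (gamma : R -> 'rV[R]_d)
    (alpha : 'I_d -> 'rV[R]_d -> R[i]) (I : R[i]) : Prop :=
  is_rough_integral p X gamma (fun j v => complex.Re (alpha j v)) (complex.Re I)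
  /\
  is_rough_integral p X gamma (fun j v => complex.Im (alpha j v)) (complex.Im I).

Definition expi (R : realType) (theta : R) : R[i] :=
  Complex (cos theta) (sin theta).

(* The one-form f(x) dy on R^2, with (x, y) = (v 0 0, v 0 1). *)
Definition form_dy (R : realType) (f : R -> R[i]) :
  'I_2 -> 'rV[R]_2 -> R[i] := fun j v => if j == 1 then f (v 0 0) else 0.

(* Main.v *)
(* Write x^n and x^k y for the words over the two letters.  Modulo the words with
   a letter y that is not last, the signature S is the matrix
   [[e^z, b(z)], [0, 1]] over R[[z]], where b(z) = sum_k S(x^k y) z^k, and its
   logarithm is [[z, c(z)], [0, 0]], so that b(z) = c(z) (e^z - 1) / z.  If log S
   has infinite radius of convergence, then c is entire, whence b(2 pi i k) = 0.
   On the other hand b_(s,t)(z) = sum_k S_(s,t)(x^k y) z^k satisfies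
   b_(0,t) - b_(0,s) = e^(z x_s) b_(s,t), and the first [p] terms of the right
   hand side are the germ of the rough integral of e^(z x) dy; geometric bounds
   on the remaining terms, from a sewing argument, show that this integral is
   b_(0,1)(z).  Everything is carried out with real numbers, for the functions
   cos (theta x + phi), theta = 2 pi k.

   The sewing argument needs a control that is small on short intervals: rather
   than proving the p-variation control to be continuous, the exponent p is
   raised slightly, to q in ]p, [p] + 1[, and the uniform continuity of the
   functional near the diagonal provides the small factor. *)
Require Import Defs.
From mathcomp Require Import all_boot all_order all_algebra.
From mathcomp Require Import all_classical all_reals all_analysis.
From mathcomp Require Import ring lra zify.

Set Implicit Arguments.
Unset Strict Implicit.
Unset Printing Implicit Defensive.

Import Order.TTheory GRing.Theory Num.Theory.
Import numFieldNormedType.Exports.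

Local Open Scope classical_set_scope.
Local Open Scope ring_scope.

(** * Taylor expansion of the cosine with remainder *)

Section Taylor.
Variable R : realType.
Implicit Types (x y phi : R) (m n : nat).

Lemma is_derive_powfact n y :
  is_derive y 1 (fun y => y ^+ n.+1 / n.+1`!%:R) (y ^+ n / n`!%:R).
Proof.
pose k := (n.+1`!%:R : R)^-1.
have -> : (fun y => y ^+ n.+1 / n.+1`!%:R) = k \*: (@idfun R ^+ n.+1).
  by apply/funext => z /=; rewrite exprfctE /GRing.scale /= mulrC.
apply: is_derive_eq; rewrite /k factS natrM /GRing.scale /= mulr1.
have := fact_gt0 n; rewrite -(ltr0n R) => h.
by field; rewrite gt_eqF //= pnatr_eq0.
Qed.

(** Each derivative of the cosine is a phase shift by [pi / 2], which treats sines and cosines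
    uniformly. [m] counts the terms, so the degree is at most [m - 1]. *)
Definition cos_taylor m phi y : R :=
  \sum_(j < m) cos (phi + j%:R * (pi / 2)) * (y ^+ j / j`!%:R).

Lemma is_derive_cos_taylor m phi y :
  is_derive y 1 (cos_taylor m.+1 phi) (cos_taylor m (phi + pi / 2) y).
Proof.
have -> : cos_taylor m.+1 phi = cst (cos phi) +
  \sum_(j < m) (cos (phi + j.+1%:R * (pi / 2)) \*:
                (fun y => y ^+ j.+1 / j.+1`!%:R)).
  apply/funext => z; rewrite /cos_taylor big_ord_recl /= fctE fct_sumE.
  by rewrite mul0r addr0 expr0 fact0 divr1 mulr1; congr (_ + _).
have h j : is_derive y (1 : R) (cos (phi + j.+1%:R * (pi / 2)) \*:
    (fun y => y ^+ j.+1 / j.+1`!%:R))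
    (cos (phi + j.+1%:R * (pi / 2)) *: (y ^+ j / j`!%:R)).
  by apply: is_deriveZ; apply: is_derive_powfact.
apply: (@is_derive_eq _ _ _ _ _ _ _ _
  (@is_deriveD _ _ _ _ _ _ _ _ _ (is_derive_cst _ _ _)
    (@is_derive_sum _ _ _ _ _ _ _ _ (fun j : 'I_m => h j)))).
rewrite add0r /cos_taylor; apply: eq_bigr => j _; rewrite /GRing.scale /=.
by congr (cos _ * _); rewrite -natr1; ring.
Qed.

Lemma is_derive_cosD phi y :
  is_derive y 1 (fun y => cos (y + phi)) (cos (y + (phi + pi / 2))).
Proof.
have -> : (fun y => cos (y + phi)) = cos \o (id + cst phi) by [].
apply: is_derive_eq.
by rewrite addrA cosDpihalf addr0 /GRing.scale /= ?mul1r ?mulr1 ?addr0.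
Qed.

(** Mean value theorem for the difference of the two sides, whose derivative is nonnegative on the
    half-line. *)
Lemma le_powfact_derive (f df : R -> R) m :
  (forall x, is_derive x 1 f (df x)) -> f 0 = 0 ->
  (forall x, 0 <= x -> df x <= x ^+ m / m`!%:R) ->
  forall x, 0 <= x -> f x <= x ^+ m.+1 / m.+1`!%:R.
Proof.
move=> fd f0 dfle x x0.
pose g := (fun y : R => y ^+ m.+1 / m.+1`!%:R) - f.
have gd y : is_derive y 1 g (y ^+ m / m`!%:R - df y).
  by apply: is_deriveB; apply: is_derive_powfact.
have gc : {within `[0, x], continuous g}.
  by apply: derivable_within_continuous => y _; apply: ex_derive.
have [c] := MVT_segment x0 (fun y _ => gd y) gc.
rewrite in_itv/= => /andP[c0 _] E.
have : 0 <= g x - g 0 by rewrite E subr0 mulr_ge0// subr_ge0 dfle.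
by rewrite /g !fctE f0 expr0n /= mul0r subr0 subr0 subr_ge0.
Qed.

(** Induction on [m] for all phases at once: the derivative of the remainder of order [m.+1] at
    phase [phi] is the remainder of order [m] at phase [phi + pi / 2]. *)
Lemma cos_taylor_ge0 m phi y : 0 <= y ->
  `|cos (y + phi) - cos_taylor m phi y| <= y ^+ m / m`!%:R.
Proof.
elim: m phi y => [|m IH] phi y y0.
  by rewrite /cos_taylor big_ord0 subr0 expr0 fact0 divr1 cos_max.
have d x : is_derive x 1 ((fun y => cos (y + phi)) - cos_taylor m.+1 phi)
    (cos (x + (phi + pi / 2)) - cos_taylor m (phi + pi / 2) x).
  by apply: is_deriveB; [apply: is_derive_cosD|apply: is_derive_cos_taylor].
have e0 : cos (0 + phi) - cos_taylor m.+1 phi 0 = 0.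
  rewrite /cos_taylor big_ord_recl /= big1 ?addr0; last first.
    by move=> j _; rewrite expr0n /= mul0r mulr0.
  by rewrite mul0r addr0 expr0 fact0 divr1 mulr1 add0r subrr.
rewrite ler_norml lerNl; apply/andP; split.
  apply: (@le_powfact_derive (- ((fun y => cos (y + phi)) - cos_taylor m.+1 phi))
     _ m (fun x => is_deriveN (d x))) => //; first by rewrite !fctE e0 oppr0.
  by move=> x x0; have := IH (phi + pi / 2) x x0; rewrite ler_norml; lra.
apply: (@le_powfact_derive ((fun y => cos (y + phi)) - cos_taylor m.+1 phi)
     _ m d) => //.
by move=> x x0; have := IH (phi + pi / 2) x x0; rewrite ler_norml; lra.
Qed.

Lemma cos_taylor_le m phi y :
  `|cos (y + phi) - cos_taylor m phi y| <= `|y| ^+ m / m`!%:R.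
Proof.
have [y0|y0] := leP 0 y; first by rewrite (ger0_norm y0); apply: cos_taylor_ge0.
have := @cos_taylor_ge0 m (- phi) (- y); rewrite (ltr0_norm y0) oppr_ge0 ltW //.
move=> /(_ isT); rewrite -opprD cosN; congr (`|_ - _| <= _).
apply: eq_bigr => j _; rewrite -(cosN (- phi + _)) opprD opprK.
(* A phase change by j pi gives the sign (-1)^j, which matches that of (-y)^j. *)
have -> : phi + j%:R * (pi / 2) = phi - j%:R * (pi / 2) + pi *+ j.
  by rewrite -mulr_natr; field.
rewrite alternatingn; last exact: cosDpi.
by rewrite [(- y) ^+ j]exprNn -!mulrA mulrCA.
Qed.
End Taylor.

(** * Sums along partitions and the sewing lemma *)

Section Sewing.
Variable R : realType.
Implicit Types (s t u a b eps delta : R) (P Q : seq R) (g : R -> R -> R)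
  (V W : R -> R).

Definition psum g s P : R := \sum_(st <- zip (s :: P) P) g st.1 st.2.

Definition step delta s t := (s <= t) && (t - s < delta).

Lemma psum_nil g s : psum g s [::] = 0.
Proof. by rewrite /psum big_nil. Qed.

Lemma psum_cons g s t P : psum g s (t :: P) = g s t + psum g t P.
Proof. by rewrite /psum /= big_cons. Qed.

Lemma psum_cat g s P Q : psum g s (P ++ Q) = psum g s P + psum g (last s P) Q.
Proof.
elim: P s => [|t P IH] s /=; first by rewrite psum_nil add0r.
by rewrite !psum_cons IH addrA.
Qed.

Lemma psum_sub g h s P :
  psum g s P - psum h s P = psum (fun s t => g s t - h s t) s P.
Proof. by rewrite /psum -sumrB. Qed.

Lemma psum_telescope V s P : psum (fun s t => V t - V s) s P = V (last s P) - V s.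
Proof.
elim: P s => [|t P IH] s; first by rewrite psum_nil subrr.
by rewrite psum_cons IH /= addrC subrKA.
Qed.

Lemma le_path_last s P : path <=%R s P -> s <= last s P.
Proof.
elim: P s => [|t P IH] s //= /andP[st /IH]; exact: le_trans.
Qed.

Lemma step_path_le delta s P : path (step delta) s P -> path <=%R s P.
Proof. by apply: sub_path => x y /andP[]. Qed.

Lemma psum_le delta g h s P :
  (forall u t, s <= u -> u <= t -> t <= last s P -> t - u < delta ->
     `|g u t| <= h u t) ->
  path (step delta) s P -> `|psum g s P| <= psum h s P.
Proof.
elim: P s => [|t P IH] s gh /=; first by rewrite !psum_nil normr0.
case/andP=> /andP[st tsd] pP; rewrite !psum_cons.
apply: le_trans (ler_normD _ _) _; apply: lerD.
  by apply: gh => //=; apply: le_path_last; apply: step_path_le pP.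
by apply: IH => // u r tu *; apply: gh => //; apply: le_trans tu.
Qed.

Lemma fine_path delta a b : 0 < delta -> a <= b ->
  exists2 P, path (step delta) a P & last a P = b.
Proof.
move=> d0 ab.
have [n] : exists n : nat, b - a <= n%:R * (delta / 2).
  exists (Num.truncn ((b - a) / (delta / 2))).+1.
  rewrite -ler_pdivrMr ?divr_gt0//; apply/ltW/truncnS_gt.
elim: n a ab => [|n IH] a ab.
  rewrite mul0r => h; exists [::] => //=; lra.
have [h _|h] := leP (b - a) (delta / 2).
  by exists [:: b] => //=; rewrite /step ab andbT; lra.
rewrite -natr1 mulrDl mul1r => h2.
have [||P h3 h4] := IH (a + delta / 2); [lra..|].
exists (a + delta / 2 :: P) => //=; rewrite h3 andbT /step; lra.
Qed.

(** [y] is the first point of [P] where [W] has made more than half of its total increment: the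
    preceding point has made at most half, and less than half remains after [y]. If there is no such
    point, [y] is the last point. *)
Lemma path_split_half W s P : P != [::] -> path <=%R s P ->
  (forall t, s <= t -> t <= last s P -> W s <= W t) ->
  exists P1 y P2, [/\ P = P1 ++ y :: P2,
    2 * (W (last s P1) - W s) <= W (last s P) - W s &
    2 * (W (last s P) - W y) <= W (last s P) - W s].
Proof.
move=> P0 pP Wm; set T := W (last s P) - W s.
have T0 : 0 <= T by rewrite subr_ge0 Wm// le_path_last.
pose big y := T < 2 * (W y - W s).
have small Q : ~~ has big Q -> 2 * (W (last s Q) - W s) <= T.
  case: (lastP Q) => [|Q' z] /=; first by rewrite subrr mulr0.
  by rewrite last_rcons has_rcons negb_or /big -leNgt => /andP[].
have [hP|hP] := boolP (has big P); last first.
  have [Q [z EP]] : exists Q z, P = rcons Q z.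
    by case/lastP: P P0 {pP Wm T T0 big small hP} => // Q z _; exists Q, z.
  exists Q, z, [::]; rewrite cats1; split => //.
    by apply: small; move: hP; rewrite EP has_rcons negb_or => /andP[].
  by rewrite {1}EP last_rcons subrr mulr0.
have [P1 [y [P2 [EP yb nb]]]] :
    exists P1 y P2, [/\ P = P1 ++ y :: P2, big y & ~~ has big P1].
  case: (split_find hP) => y P1 P2 yb nb.
  by exists P1, y, P2; rewrite cat_rcons.
exists P1, y, P2; split => //; first exact: small.
by move: yb; rewrite /big /T; lra.
Qed.

Lemma powR_half2 (theta c T T' : R) : 0 <= theta -> 2 * 2^-1 `^ theta <= c ->
  0 <= T -> 0 <= T' -> 2 * T' <= T -> 2 * T' `^ theta <= c * T `^ theta.
Proof.
move=> th0 hc T0 T'0 h.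
have : T' `^ theta <= (2^-1 * T) `^ theta.
  by apply: ge0_ler_powR; rewrite ?nnegrE //; lra.
rewrite powRM ?invr_ge0 // => h2.
have := ler_wpM2r (powR_ge0 T theta) hc; lra.
Qed.

(* Cutting P at an interval such that neither remaining piece carries more than
   half of the increment of W (instead of dropping one point at a time, as in
   Young's argument) gives a constant uniform in all large theta. *)
Lemma sewing (g : R -> R -> R) W (a b D theta c : R) :
  0 <= D -> 0 < theta -> 2 * 2^-1 `^ theta <= c -> c < 1 ->
  (forall s t, a <= s -> s <= t -> t <= b -> W s <= W t) ->
  (forall s t u, a <= s -> s <= t -> t <= u -> u <= b ->
     `|g s u - g s t - g t u| <= D * (W u - W s) `^ theta) ->
  forall s P, a <= s -> path <=%R s P -> last s P <= b ->
  `|g s (last s P) - psum g s P|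
     <= 2 * D / (1 - c) * (W (last s P) - W s) `^ theta.
Proof.
move=> D0 th0 hc c1 Wm gD s P; set C := 2 * D / (1 - c).
have C0 : 0 <= C by rewrite divr_ge0 ?mulr_ge0// subr_ge0 ltW.
have [n] := ubnP (size P); elim: n s P => // n IH s P sP as_ pP lb.
have sl := le_path_last pP.
have [P0|P0] := eqVneq P [::].
  (* On a degenerate interval the defect inequality forces [g s s = 0], because [theta] is
     positive. *)
  have := gD s s s as_ (lexx _) (lexx _) (le_trans sl lb).
  rewrite P0 /= psum_nil !subrr powR0 ?gt_eqF// !mulr0 sub0r normrN.
  by rewrite subr0.
have Wm' t : s <= t -> t <= last s P -> W s <= W t.
  by move=> st tl; apply: Wm => //; apply: le_trans tl lb.
have [P1 [y [P2 [EP h1 h2]]]] := path_split_half P0 pP Wm'.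
move: sP pP lb sl h1 h2 {P0 Wm'}; rewrite {}EP size_cat /= last_cat /=.
set r := last s P1; set t := last y P2 => sP.
rewrite cat_path /= -/r => /and3P[p1 ry p2] tb st h1 h2.
have sr : s <= r := le_path_last p1.
have yt : y <= t := le_path_last p2.
have rb : r <= b by apply: le_trans tb; apply: le_trans yt.
have ay : a <= y by apply: le_trans as_ _; apply: le_trans ry.
have z1 : (size P1 < n)%N.
  by move: sP; rewrite ltnS addnS; apply: leq_ltn_trans; rewrite leq_addr.
have z2 : (size P2 < n)%N.
  by move: sP; rewrite ltnS addnS; apply: leq_ltn_trans; rewrite leq_addl.
have := IH s P1 z1 as_ p1 rb; rewrite -/r => I1.
have := IH y P2 z2 ay p2 tb; rewrite -/t => I2.
have d1 := gD s r t as_ sr (le_trans ry yt) tb.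
have d2 := gD r y t (le_trans as_ sr) ry yt tb.
have Wsr := Wm s r as_ sr rb.
have Wyt := Wm y t ay yt tb.
have Wst := Wm s t as_ st tb.
have Wry := Wm r y (le_trans as_ sr) ry (le_trans yt tb).
have k1 := @powR_half2 theta c _ _ (ltW th0) hc _ _ h1.
have k2 := @powR_half2 theta c _ _ (ltW th0) hc _ _ h2.
have k3 : (W t - W r) `^ theta <= (W t - W s) `^ theta.
  by apply: ge0_ler_powR; rewrite ?nnegrE; [exact: ltW|lra..].
(* [C] is the fixed point of the recursion: isolating the interval from [r] to [y] costs two
   defects, and the two remaining pieces cost at most [C * c / 2] each. *)
have CE : 2 * D + C * c = C by rewrite /C; field; rewrite subr_eq0 gt_eqF.
rewrite psum_cat psum_cons -/r.
set w := (W t - W s) `^ theta in k1 k2 k3 d1 *.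
have w0 : 0 <= w by apply: powR_ge0.
have {}k1 : C * (W r - W s) `^ theta <= C * (c * w / 2).
  by apply: ler_wpM2l => //; lra.
have {}k2 : C * (W t - W y) `^ theta <= C * (c * w / 2).
  by apply: ler_wpM2l => //; lra.
have {}d2 := le_trans d2 (ler_wpM2l D0 k3).
have -> : C * w = D * w + D * w + (C * (c * w / 2) + C * (c * w / 2)).
  by rewrite -{1}CE; field.
move: I1 I2 d1 d2; rewrite !ler_norml; lra.
Qed.

(** The smallness assumption makes the sums of [g] along fine paths negligible, because the
    increments of [V] telescope; [sewing] compares [g a b] with such a sum. *)
Lemma sewing_small (g : R -> R -> R) W V (a b D theta c : R) :
  a <= b -> 0 <= D -> 0 < theta -> 2 * 2^-1 `^ theta <= c -> c < 1 ->
  (forall s t, a <= s -> s <= t -> t <= b -> W s <= W t) ->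
  (forall s t u, a <= s -> s <= t -> t <= u -> u <= b ->
     `|g s u - g s t - g t u| <= D * (W u - W s) `^ theta) ->
  (forall eta, 0 < eta -> exists2 delta, 0 < delta &
     forall s t, a <= s -> s <= t -> t <= b -> t - s < delta ->
     `|g s t| <= eta * (V t - V s)) ->
  `|g a b| <= 2 * D / (1 - c) * (W b - W a) `^ theta.
Proof.
move=> ab D0 th0 hc c1 Wm gD gV; apply/ler_addgt0Pr => e e0.
pose eta := e / (1 + `|V b - V a|).
have V1 : 0 < 1 + `|V b - V a| by rewrite ltr_wpDr.
have eta0 : 0 < eta by rewrite divr_gt0.
have [delta d0 hd] := gV _ eta0.
have [P pP lP] := fine_path d0 ab.
have hg s t : a <= s -> s <= t -> t <= b -> t - s < delta ->
    `|g s t| <= eta * V t - eta * V s.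
  by move=> *; rewrite -mulrBr; apply: hd.
have := @psum_le delta g (fun s t => eta * V t - eta * V s) a P.
rewrite lP => /(_ hg pP).
rewrite (psum_telescope (fun t => eta * V t)) lP -mulrBr.
have := sewing D0 th0 hc c1 Wm gD (lexx a) (step_path_le pP).
rewrite lP => /(_ (lexx _)).
have : eta * (V b - V a) <= e.
  rewrite /eta mulrAC ler_pdivrMr// ler_pM2l//.
  by apply: le_trans (ler_norm _) _; rewrite lerDr.
rewrite !ler_norml; lra.
Qed.
End Sewing.

(** * Finite variation and smallness on short intervals *)

Section Control.
Variable R : realType.
Implicit Types (s t u e eps eta delta : R) (P : seq R) (g : R -> R -> R)
  (V : R -> R).

(** The control is the increment of one function of time, hence additive, so that its sums along
    partitions telescope. No continuity of [V] is required. *)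
Definition controlled e g V := forall s t, 0 <= s -> s <= t -> t <= 1 ->
  `|g s t| `^ e <= V t - V s.

Definition vanishing g := forall eps, 0 < eps -> exists2 delta, 0 < delta &
  forall s t, 0 <= s -> s <= t -> t <= 1 -> t - s < delta -> `|g s t| < eps.

Lemma itv_partition_rcons s t P :
  itv_partition 0 s P -> s < t -> itv_partition 0 t (rcons P t).
Proof.
by case=> pP /eqP lP st; split; rewrite ?last_rcons// rcons_path pP lP.
Qed.

(** [V t] is the variation of [g] over [0, t]. Appending [t] to a partition of [0, s] shows that its
    increment dominates the single term from [s] to [t]. *)
Lemma exists_controlled e g M : 0 < e -> (forall s, 0 <= s <= 1 -> g s s = 0) ->
  (forall P, itv_partition 0 1 P ->
     psum (fun s t => `|g s t| `^ e) 0 P <= M) ->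
  exists V, controlled e g V.
Proof.
move=> e0 g0 hM; pose h s t := `|g s t| `^ e.
pose A t := [set psum h 0 P | P in [set P | itv_partition 0 t P]].
have AM t : t <= 1 -> ubound (A t) M.
  rewrite le_eqVlt => /predU1P[->|t1] _ [P /= hP <-]; first exact: hM.
  have := hM _ (itv_partition_rcons hP t1).
  rewrite -cats1 psum_cat psum_cons psum_nil addr0; apply: le_trans.
  by rewrite lerDl powR_ge0.
have A0 t : 0 <= t -> A t !=set0.
  rewrite le_eqVlt => /predU1P[<-|t0].
    by exists (psum h 0 [::]); exists [::] => //=; split.
  by exists (psum h 0 [:: t]); exists [:: t] => //=; split => //=; rewrite t0.
exists (fun t => sup (A t)) => s t s0; rewrite le_eqVlt => /predU1P[<-|st] t1.
  by rewrite g0 ?s0 ?t1// normr0 powR0 ?gt_eqF// subrr.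
rewrite lerBrDr -lerBrDl; apply: sup_le_ub; first exact: A0.
move=> _ [P /= hP <-]; rewrite lerBrDl addrC.
apply: sup_upper_bound.
  by split; [exact: A0 (le_trans s0 (ltW st))|exists M; exact: AM].
exists (rcons P t); first exact: itv_partition_rcons hP st.
by rewrite -cats1 psum_cat psum_cons psum_nil addr0 (eqP hP.2).
Qed.

(** Compactness of [0, 1] makes the local moduli of continuity uniform. *)
Lemma vanishing_diagonal g :
  (forall t, 0 <= t <= 1 -> forall eps, 0 < eps -> exists2 delta, 0 < delta &
     forall s u, 0 <= s -> s <= u -> u <= 1 ->
       `|s - t| < delta -> `|u - t| < delta -> `|g s u| < eps) ->
  vanishing g.
Proof.
move=> hg eps e0.
have /compact_near_coveringP cK := @segment_compact R 0 1.
pose Q delta s := forall u, 0 <= s -> s <= u -> u <= 1 -> u - s < delta ->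
  `|g s u| < eps.
(* The near-covering form of compactness: a property that holds for small [d] locally around each
   point holds for small [d] on the whole segment. *)
have : \forall d \near 0^'+, `[0, 1] `<=` Q d.
  apply: cK => t; rewrite /= in_itv /= => t01.
  have [d d0 hd] := hg t t01 _ e0.
  exists ([set s | `|t - s| < d / 2], [set i | i < d / 2]).
    split; first by apply: nbhsx_ballx; rewrite divr_gt0.
    by apply: nbhs_right_lt; rewrite divr_gt0.
  move=> [s i] [/= ts id] u s0 su u1 usi; apply: hd => //.
    by move: ts; rewrite distrC; lra.
  by move: ts; rewrite !ltr_norml; lra.
move=> /(@filterI _ _ _ _ _ (nbhs_right_gt 0)) /filter_ex[d [d0 hd]].
exists d => // s t s0 st t1; apply: hd => //=.
by rewrite in_itv/= s0 (le_trans st).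
Qed.

(** Split the power [e'] into [e' - e] and [e]: the first factor is at most [eta] near the diagonal,
    and the second is controlled by [V]. *)
Lemma controlled_small e e' g V :
  0 < e -> e < e' -> controlled e g V -> vanishing g ->
  forall eta, 0 < eta -> exists2 delta, 0 < delta &
  forall s t, 0 <= s -> s <= t -> t <= 1 -> t - s < delta ->
    `|g s t| `^ e' <= eta * (V t - V s).
Proof.
move=> e0 ee' gV gc eta eta0; have d0 : 0 < e' - e by rewrite subr_gt0.
have [|delta delta0 hd] := gc (eta `^ (e' - e)^-1); first exact: powR_gt0.
exists delta => // s t s0 st t1 std.
have h1 := gV s t s0 st t1; have h2 := hd s t s0 st t1 std.
have [->|g0] := eqVneq (g s t) 0.
  rewrite normr0 powR0 ?gt_eqF// ?(lt_trans e0)//.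
  by rewrite mulr_ge0 ?(ltW eta0)//; apply: le_trans h1; exact: powR_ge0.
have -> : e' = (e' - e) + e by rewrite subrK.
rewrite powRD; last by rewrite normr_eq0 g0 implybT.
apply: ler_pM => //; rewrite ?powR_ge0//.
rewrite -[leRHS](powRr1 (ltW eta0)) -(@mulVf _ (e' - e)) ?gt_eqF//.
rewrite powRrM; apply: ge0_ler_powR; rewrite ?nnegrE ?powR_ge0//; exact: ltW.
Qed.
End Control.

(** * Geometric bounds on the coefficients of the words x^k y *)

Section GeometricBound.
Variable R : realType.
Implicit Types (x W : R -> R) (b : nat -> R -> R -> R) (V : nat -> R -> R)
  (q theta K T y : R).

Lemma sum_geo_half y n : 0 <= y <= 2^-1 -> \sum_(i < n) y ^+ i <= 2.
Proof.
move=> /andP[y0 y2]; have := subrX1 y n; have := exprn_ge0 n y0.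
have : 0 <= \sum_(i < n) y ^+ i by apply: sumr_ge0 => i _; exact: exprn_ge0.
nra.
Qed.

Lemma sum_geo_ge2 K n : 2 <= K -> \sum_(i < n) K ^+ i <= K ^+ n * (2 / K).
Proof.
move=> K2; have K0 : 0 < K by lra.
rewrite mulrA ler_pdivlMr//; have := subrX1 K n.
have : 0 <= \sum_(i < n) K ^+ i.
  by apply: sumr_ge0 => i _; rewrite exprn_ge0// ltW.
nra.
Qed.

Lemma powR_inv_le y e T : 0 <= y -> 0 < e -> y `^ e <= T -> y <= T `^ e^-1.
Proof.
move=> y0 e0 h; rewrite -(powRr1 y0) -(@mulfV _ e) ?gt_eqF// powRrM.
apply: ge0_ler_powR => //; rewrite ?nnegrE ?powR_ge0 ?invr_ge0 ?(ltW e0)//.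
by apply: le_trans h; exact: powR_ge0.
Qed.

Lemma powR_invX T q n : (T `^ q^-1) ^+ n = T `^ (n%:R / q).
Proof. by rewrite -powR_mulrn ?powR_ge0// -powRrM mulrC. Qed.

Lemma half_powR_lt1 theta : 1 < theta -> 2 * 2^-1 `^ theta < 1 :> R.
Proof.
move=> th1; have -> : theta = 1 + (theta - 1) by rewrite addrC subrK.
rewrite powRD ?invr_eq0 ?pnatr_eq0 ?implybT// powRr1 ?invr_ge0//.
have e1 : 1 `^ (theta - 1) = 1 :> R by rewrite powR1.
rewrite mulrA mulfV ?pnatr_eq0// mul1r -[ltRHS]e1.
by apply: gt0_ltr_powR; rewrite ?subr_gt0 ?nnegrE ?invr_ge0 ?invf_lt1// ltr1n.
Qed.

Lemma ord_subn k (i : 'I_k) : [/\ (k - i.+1 < k)%N,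
  (i.+1 + (k - i.+1).+1 = k.+1)%N & (k - (k - i.+1).+1 = i)%N].
Proof. by have := ltn_ord i; split; lia. Qed.

(* Chen's relation for the coefficients of the words x^k y, given that the
   coefficient of x^j is (x_t - x_s)^j / j!. *)
Definition chen_xy x b := forall k s t u, 0 <= s -> s <= t -> t <= u -> u <= 1 ->
  b k s u = b k s t +
    \sum_(j < k.+1) (x t - x s) ^+ j / j`!%:R * b (k - j)%N t u.

(** Strong induction on [k]. From level [N] on, Chen's relation bounds the defect of [b k] by lower
    levels, with an exponent [k.+1 / q > 1], and [sewing_small] applies. [K] depends on [q] and [N]
    only; the interval from [l] to [r] is free so that the bound can be used on short intervals. *)
Lemma chen_xy_bound q (N : nat) : 0 < q -> q < N.+1%:R ->
  exists2 K, 1 <= K & forall x b W V l r, 0 <= l -> r <= 1 -> chen_xy x b ->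
  (forall s t, l <= s -> s <= t -> t <= r -> W s <= W t) ->
  (forall s t, l <= s -> s <= t -> t <= r ->
     `|x t - x s| <= (W t - W s) `^ q^-1) ->
  (forall k s t, (k < N)%N -> l <= s -> s <= t -> t <= r ->
     `|b k s t| <= ((W t - W s) `^ q^-1) ^+ k.+1) ->
  (forall k eta, (N <= k)%N -> 0 < eta -> exists2 delta, 0 < delta &
     forall s t, l <= s -> s <= t -> t <= r -> t - s < delta ->
     `|b k s t| <= eta * (V k t - V k s)) ->
  forall k s t, l <= s -> s <= t -> t <= r ->
    `|b k s t| <= K ^+ k * ((W t - W s) `^ q^-1) ^+ k.+1.
Proof.
(* The smallest exponent to be sewn is [N.+1 / q], so this [c] serves all levels [k >= N]. *)
move=> q0 qN; pose c : R := 2 * 2^-1 `^ (N.+1%:R / q).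
have c1 : c < 1 by apply: half_powR_lt1; rewrite ltr_pdivlMr// mul1r.
have c0 : 0 <= c by rewrite mulr_ge0// powR_ge0.
(* With [D = K ^+ k * (2 / K)] below, this value makes the sewing constant [2 * D / (1 - c)] equal
   to [K ^+ k], which closes the induction. *)
pose K := 4 / (1 - c).
have K4 : 4 <= K by rewrite ler_pdivlMr; lra.
have K1 : 1 <= K by lra.
exists K => // x b W V l r l0 r1 chen Wm hx hb hV k.
have [n] := ubnP k; elim: n k => // n IH k kn s t ls st tr.
have [kN|Nk] := ltnP k N.
  apply: le_trans (hb _ _ _ kN ls st tr) _.
  by rewrite ler_peMl ?exprn_ge0 ?powR_ge0// exprn_ege1.
pose theta := k.+1%:R / q; pose D := K ^+ k * (2 / K).
have K0 : 0 < K by lra.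
have D0 : 0 <= D by rewrite mulr_ge0 ?exprn_ge0 ?divr_ge0//; lra.
have th0 : 0 < theta by rewrite divr_gt0.
have hc : 2 * 2^-1 `^ theta <= c.
  rewrite ler_pM2l//; apply: ger_powR.
    by rewrite invr_gt0 invf_le1// ltr0n ler1n.
  by rewrite ler_pM2r ?invr_gt0// ler_nat ltnS.
have := @sewing_small R (b k) W (V k) s t D theta c st D0 th0 hc c1.
have -> : 2 * D / (1 - c) = K ^+ k.
  have cn : 1 - c != 0 by rewrite subr_eq0 gt_eqF.
  by rewrite /D {2}/K; field.
rewrite powR_invX; apply.
- by move=> s' t' *; apply: Wm => //; lra.
- move=> a d e sa ad de et.
  have {}et : e <= r by lra.
  have la : l <= a by lra.
  rewrite (chen k a d e); [|lra..].
  (* The term j = 0 of Chen's relation is [b k d e]; the defect [S] thus involves only levels below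
     [k]. *)
  rewrite big_ord_recl /= expr0 fact0 divr1 mul1r subn0.
  set S := \sum_(i < k) _; rewrite [X in `|X|](_ : _ = S); last by ring.
  rewrite -powR_invX; set rho := (W e - W a) `^ q^-1.
  have rho0 : 0 <= rho by apply: powR_ge0.
  have h1 : (W d - W a) `^ q^-1 <= rho.
    have := Wm a d; have := Wm d e => *.
    by apply: ge0_ler_powR; rewrite ?nnegrE ?invr_ge0 ?(ltW q0)//; lra.
  have h2 : (W e - W d) `^ q^-1 <= rho.
    have := Wm a d; have := Wm d e => *.
    by apply: ge0_ler_powR; rewrite ?nnegrE ?invr_ge0 ?(ltW q0)//; lra.
  apply: (@le_trans _ _ (\sum_(i < k) K ^+ (k - i.+1) * rho ^+ k.+1)).
    apply: le_trans (ler_norm_sum _ _ _) _; apply: ler_sum => i _.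
    rewrite /bump /= add1n !normrM normfV normrX [X in _ / X]ger0_norm//.
    have [ik ik1 _] := ord_subn i.
    have h3 := IH _ (leq_trans ik kn) d e (le_trans la ad) de et.
    have -> : rho ^+ k.+1 = rho ^+ i.+1 * rho ^+ (k - i.+1).+1.
      by rewrite -exprD ik1.
    rewrite mulrCA; apply: ler_pM => //.
      rewrite ler_pdivrMr ?ltr0n ?fact_gt0//.
      apply: (@le_trans _ _ (rho ^+ i.+1)).
        by apply: lerXn2r; rewrite ?nnegrE//; apply: le_trans h1; apply: hx; lra.
      by rewrite ler_peMr ?exprn_ge0// ler1n fact_gt0.
    apply: le_trans h3 _; apply: ler_wpM2l; first by rewrite exprn_ge0// ltW.
    by apply: lerXn2r; rewrite ?nnegrE ?powR_ge0.
  rewrite -mulr_suml; apply: ler_wpM2r; first exact: exprn_ge0.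
  rewrite (reindex_inj rev_ord_inj) /=; under eq_bigr => i _.
    have [_ _ ->] := ord_subn i.
  over.
  by apply: sum_geo_ge2; lra.
- move=> eta eta0; have [d d0 hd] := hV k eta Nk eta0.
  by exists d => // *; apply: hd => //; lra.
Qed.
End GeometricBound.

(** * Sums of the germ compared with the truncated series *)

Section RoughSums.
Variable R : realType.
Implicit Types (x V W : R -> R) (b : nat -> R -> R -> R)
  (q theta phi tau y : R) (M N k n : nat) (P : seq R).

(* The n-th derivative of y |-> cos (theta * y + phi) *)
Definition cosn theta phi n y : R :=
  theta ^+ n * cos (theta * y + (phi + n%:R * (pi / 2))).

Definition cosn_taylor theta phi M n y : R :=
  \sum_(j < M) cosn theta phi (n + j) 0 * (y ^+ j / j`!%:R).

Lemma cosn_taylorE theta phi M n y : cosn_taylor theta phi M n y =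
  theta ^+ n * cos_taylor M (phi + n%:R * (pi / 2)) (theta * y).
Proof.
rewrite /cosn_taylor /cos_taylor mulr_sumr; apply: eq_bigr => j _.
rewrite /cosn mulr0 add0r exprD exprMn natrD mulrDl -(addrA phi).
by rewrite -!mulrA; congr (_ * _); rewrite [LHS]mulrCA.
Qed.

Lemma cosn_le theta phi n y : `|cosn theta phi n y| <= `|theta| ^+ n.
Proof. by rewrite normrM normrX ler_piMr ?exprn_ge0// cos_max. Qed.

(** (4y)^M / M! is a single term of the exponential series at 4y. The factor 4^-M provides the
    geometric decay of the Taylor remainders. *)
Lemma powfact_le_expR y M : 0 <= y -> y ^+ M / M`!%:R <= expR (y *+ 4) / 4 ^+ M.
Proof.
move=> y0; rewrite ler_pdivlMr ?exprn_gt0// mulrAC -exprMn mulr_natr.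
case: M => [|M].
  rewrite expr0 fact0 divr1; apply: le_trans (expR_ge1Dx _).
  by rewrite lerDl mulrn_wge0.
apply: le_trans (expR_ge1Dxn M _); last by rewrite mulrn_wge0.
by rewrite lerDr.
Qed.

Lemma cosn_taylor_le theta phi M n y :
  `|cosn_taylor theta phi M n y - cosn theta phi n y| <=
  `|theta| ^+ n * (expR (`|theta * y| *+ 4) / 4 ^+ M).
Proof.
rewrite cosn_taylorE /cosn -mulrBr normrM normrX ler_wpM2l ?exprn_ge0//.
rewrite distrC; apply: le_trans (powfact_le_expR _ _) => //.
exact: cos_taylor_le.
Qed.

Lemma exchange_triangle (V : nmodType) (G : nat -> nat -> V) M :
  \sum_(n < M) \sum_(j < n.+1) G j (n - j)%N =
  \sum_(k < M) \sum_(j < M - k) G j k.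
Proof.
elim: M => [|M IH]; first by rewrite !big_ord0.
rewrite big_ord_recr IH /= [RHS]big_ord_recr /= subSnn big_ord1.
under [in RHS]eq_bigr => k _.
  rewrite (_ : M.+1 - k = (M - k).+1)%N ?big_ord_recr /=; last first.
    by rewrite subSn // ltnW.
  over.
rewrite big_split -addrA; congr (_ + _).
rewrite (reindex_inj rev_ord_inj) /= big_ord_recr /= subnn subn0.
congr (_ + _); apply: eq_bigr => i _.
by rewrite subKn // ltnW // ltn_ord.
Qed.

(** Truncated form of b_(0,t) - b_(0,s) = e^(z x_s) b_(s,t): collecting the terms of Chen's relation
    with the same k = n - j turns the powers of x_s into a Taylor polynomial with [M - k] terms. *)
Lemma cosn_chen_sum theta phi x b M s t : chen_xy x b -> x 0 = 0 ->
  0 <= s -> s <= t -> t <= 1 ->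
  \sum_(n < M) cosn theta phi n 0 * b n 0 t -
    \sum_(n < M) cosn theta phi n 0 * b n 0 s =
  \sum_(k < M) cosn_taylor theta phi (M - k) k (x s) * b k s t.
Proof.
move=> chen x0 s0 st t1.
transitivity (\sum_(n < M) \sum_(j < n.+1)
    cosn theta phi (n - j + j) 0 * (x s ^+ j / j`!%:R) * b (n - j)%N s t).
  rewrite -sumrB; apply: eq_bigr => n _; rewrite (chen n 0 s t)// x0 subr0.
  rewrite -mulrBr [b n 0 s + _]addrC addrK mulr_sumr; apply: eq_bigr => j _.
  by rewrite subnK ?mulrA// -ltnS.
rewrite (exchange_triangle
  (fun j k => cosn theta phi (k + j) 0 * (x s ^+ j / j`!%:R) * b k s t)).
by apply: eq_bigr => k _; rewrite mulr_suml.
Qed.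

Definition cosn_germ theta phi N x b s t : R :=
  \sum_(k < N) cosn theta phi k (x s) * b k s t.

(* The first error term collects the levels N <= k < M, the second one the
   Taylor remainders. *)
Lemma cosn_germ_le theta phi N K x b s t rho M : (N <= M)%N -> 0 <= rho ->
  0 <= K -> `|theta| * (K * rho) <= 2^-1 ->
  (forall k, `|b k s t| <= K ^+ k * rho ^+ k.+1) ->
  `|\sum_(k < M) cosn_taylor theta phi (M - k) k (x s) * b k s t -
    cosn_germ theta phi N x b s t| <=
  2 * (`|theta| * K) ^+ N * rho ^+ N.+1 +
  2^-1 ^+ M * (2 * (rho * expR (`|theta * x s| *+ 4))).
Proof.
move=> NM rho0 K0 small hb; set z := `|theta| * (K * rho) in small.
have z0 : 0 <= z by rewrite !mulr_ge0.
have zE k : `|theta| ^+ k * (K ^+ k * rho ^+ k.+1) = rho * z ^+ k.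
  by rewrite !exprMn exprS; ring.
set E := expR _; have E0 : 0 <= E by apply: expR_ge0.
rewrite (_ : \sum_(k < M) _ - _ =
  \sum_(i < M - N) cosn theta phi (N + i) (x s) * b (N + i)%N s t +
  \sum_(k < M) (cosn_taylor theta phi (M - k) k (x s) -
     cosn theta phi k (x s)) * b k s t); last first.
  under [X in _ = _ + X]eq_bigr => k _ do rewrite mulrBl.
  rewrite sumrB [RHS]addrCA; congr (_ + _).
  rewrite -[X in _ - X](big_mkord xpredT
    (fun k => cosn theta phi k (x s) * b k s t)) /cosn_germ.
  rewrite (@big_cat_nat _ _ _ N) //= big_mkord.
  rewrite -[X in \sum_(X <= _ < M) _]add0n big_addn big_mkord.
  under [X in _ - (_ + X)]eq_bigr => i _ do rewrite addnC.
  by rewrite opprD [RHS]addrCA subrr addr0.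
apply: le_trans (ler_normD _ _) _; apply: lerD.
  apply: le_trans (ler_norm_sum _ _ _) _.
  apply: (@le_trans _ _ (\sum_(i < M - N) rho * z ^+ N * z ^+ i)).
    apply: ler_sum => i _; rewrite normrM -mulrA -exprD -zE.
    by apply: ler_pM => //; apply: cosn_le.
  rewrite -mulr_sumr [leRHS](_ : _ = rho * z ^+ N * 2); last first.
    by rewrite !exprMn exprS; ring.
  by apply: ler_wpM2l; rewrite ?sum_geo_half ?z0// mulr_ge0// exprn_ge0.
apply: le_trans (ler_norm_sum _ _ _) _.
(* The remainder contributes 4^-(M-k). One factor 2^-(M-k) joins z^k <= 2^-k to give 2^-M; the other
   one is summed over k. *)
apply: (@le_trans _ _ (\sum_(k < M) 2^-1 ^+ M * (rho * E) * 2^-1 ^+ (M - k))).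
  apply: ler_sum => k _; rewrite normrM.
  apply: (@le_trans _ _ (`|theta| ^+ k * (E / 4 ^+ (M - k)) *
      (K ^+ k * rho ^+ k.+1))).
    by apply: ler_pM => //; apply: cosn_taylor_le.
  rewrite mulrAC zE.
  have -> : 2^-1 ^+ M = 2^-1 ^+ k * 2^-1 ^+ (M - k) :> R.
    by rewrite -exprD subnKC// ltnW.
  have -> : 4 ^+ (M - k) = (2 ^+ (M - k)) * 2 ^+ (M - k) :> R.
    by rewrite -exprMn -natrM.
  rewrite invfM -!exprVn.
  have : z ^+ k <= 2^-1 ^+ k.
    by apply: lerXn2r; rewrite ?nnegrE ?invr_ge0.
  set u := 2^-1 ^+ (M - k); have u0 : 0 <= u by rewrite exprn_ge0 ?invr_ge0.
  move=> /(ler_wpM2l (mulr_ge0 (mulr_ge0 rho0 E0) (mulr_ge0 u0 u0))).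
  by congr (_ <= _); ring.
rewrite -mulr_sumr -mulrA; apply: ler_wpM2l; first by rewrite exprn_ge0 ?invr_ge0.
rewrite mulrC; apply: ler_wpM2r; first by rewrite mulr_ge0.
rewrite (reindex_inj rev_ord_inj) /=.
apply: (le_trans _ (@sum_geo_half R 2^-1 M _)); last by rewrite invr_ge0 lexx ler0n.
apply: ler_sum => i _; rewrite subKn//.
by apply: ler_wiXn2l; rewrite ?invr_ge0 ?invf_le1 ?ltr0n ?ler1n.
Qed.

Lemma exists_small_powR e1 e2 A B eps : 0 < e1 -> 0 < e2 -> 0 <= A -> 0 <= B ->
  0 < eps -> exists2 tau : R, 0 < tau & A * tau `^ e1 <= eps /\ B * tau `^ e2 <= eps.
Proof.
move=> e10 e20 A0 B0 eps0.
have h C e : 0 < e -> 0 <= C -> exists2 tau : R, 0 < tau & C * tau `^ e <= eps.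
  move=> e0 C0; exists ((eps / (C + 1)) `^ e^-1).
    by rewrite powR_gt0// divr_gt0// ltr_wpDl.
  have D0 : 0 <= eps / (C + 1) by rewrite divr_ge0 ?addr_ge0 ?(ltW eps0).
  rewrite -powRrM mulVf ?gt_eqF// powRr1//.
  by rewrite mulrCA ler_piMr ?(ltW eps0)// ler_pdivrMr ?ltr_wpDl// mul1r lerDl.
have [t1 t10 h1] := h A e1 e10 A0; have [t2 t20 h2] := h B e2 e20 B0.
have m0 : 0 < Num.min t1 t2 by rewrite lt_min t10.
exists (Num.min t1 t2) => //.
split; [apply: le_trans h1|apply: le_trans h2]; apply: ler_wpM2l => //.
  by apply: ge0_ler_powR; rewrite ?nnegrE ?ge_min ?lexx//; exact: ltW.
by apply: ge0_ler_powR; rewrite ?nnegrE ?ge_min ?lexx ?orbT//; exact: ltW.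
Qed.

Lemma step_sub (l r s t delta : R) : 0 <= l -> r <= 1 -> r - l < delta ->
  l <= s -> s <= t -> t <= r -> [/\ 0 <= s, t <= 1 & t - s < delta].
Proof. by split; lra. Qed.

(** On short intervals the germ is close to the increment of the partial sum [I M], which telescopes
    to [I M 1] and tends to 0. The first error is superlinear in the increments of [W], hence small
    uniformly in the partition; the second vanishes as M grows with the partition fixed. *)
Lemma cosn_germ_sum theta phi q N x b V (Vk : nat -> R -> R) :
  0 < q -> q < N.+1%:R -> chen_xy x b -> x 0 = 0 ->
  (forall s t, 0 <= s -> s <= t -> t <= 1 -> V s <= V t) ->
  (forall eta, 0 < eta -> exists2 delta, 0 < delta &
     forall s t, 0 <= s -> s <= t -> t <= 1 -> t - s < delta ->
     `|x t - x s| `^ q <= eta * (V t - V s) /\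
     forall k, (k < N)%N -> `|b k s t| `^ (q / k.+1%:R) <= eta * (V t - V s)) ->
  (forall k eta, (N <= k)%N -> 0 < eta -> exists2 delta, 0 < delta &
     forall s t, 0 <= s -> s <= t -> t <= 1 -> t - s < delta ->
     `|b k s t| <= eta * (Vk k t - Vk k s)) ->
  (fun M => \sum_(n < M) cosn theta phi n 0 * b n 0 1) @ \oo --> 0 ->
  forall eps, 0 < eps -> exists2 delta, 0 < delta &
    forall P, path (step delta) 0 P -> last 0 P = 1 ->
    `|psum (cosn_germ theta phi N x b) 0 P| <= eps.
Proof.
move=> q0 qN chen x0 Vm hV hVk lim eps eps0.
have [K K1 bound] := chen_xy_bound q0 qN.
have K0 : 0 <= K by lra.
pose th := N.+1%:R / q.
have th1 : 0 < th - 1 by rewrite subr_gt0 ltr_pdivlMr// mul1r.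
pose v := V 1 - V 0; have v0 : 0 <= v by rewrite subr_ge0 Vm.
pose C := 2 * (`|theta| * K) ^+ N.
have C0 : 0 <= C by rewrite mulr_ge0// exprn_ge0// mulr_ge0.
(* One threshold for two purposes: the bound 1/2 keeps the ratio in [cosn_germ_le] small enough, and
   the bound [eps] controls the accumulated error. *)
pose e0 := Num.min eps 2^-1.
have e00 : 0 < e0 by rewrite lt_min eps0 invr_gt0 ltr0n.
have [|||tau tau0 [t1 t2]] :=
  @exists_small_powR q^-1 (th - 1) (`|theta| * K) (C * v) e0 _ th1 _ _ e00.
- by rewrite invr_gt0.
- by rewrite mulr_ge0.
- by rewrite mulr_ge0.
(* With this factor all increments of [W = eta * V] are at most [tau] and at most [v]. *)
pose eta := Num.min 1 (tau / (v + 1)).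
have eta0 : 0 < eta by rewrite lt_min ltr01 divr_gt0// ltr_wpDl.
have eta1 : eta <= 1 by rewrite ge_min lexx.
have etav : eta * v <= tau.
  apply: (@le_trans _ _ (tau / (v + 1) * v)).
    by rewrite ler_wpM2r// ge_min lexx orbT.
  by rewrite mulrAC ler_pdivrMr ?ltr_wpDl// ler_wpM2l ?(ltW tau0)// lerDl.
have [delta delta0 hd] := hV _ eta0.
pose W t := eta * V t.
have Wm s t : 0 <= s -> s <= t -> t <= 1 -> W s <= W t.
  by move=> *; rewrite ler_wpM2l ?(ltW eta0)// Vm.
pose rho s t := (W t - W s) `^ q^-1.
have hb k s t : 0 <= s -> s <= t -> t <= 1 -> t - s < delta ->
    `|b k s t| <= K ^+ k * rho s t ^+ k.+1.
  move=> s0 st t1' std.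
  (* The bound is applied on the interval from [s] to [t] itself, which is shorter than [delta], so
     [W] dominates all its subintervals. *)
  apply: (bound x b W Vk s t) => //.
  - by move=> s' t' h1 h2 h3; have [] := step_sub s0 t1' std h1 h2 h3; auto.
  - move=> s' t' h1 h2 h3; rewrite /W -mulrBr; apply: powR_inv_le => //.
    have [z1 z2 z3] := step_sub s0 t1' std h1 h2 h3.
    by have [] := hd s' t' z1 h2 z2 z3.
  - move=> k' s' t' k'N h1 h2 h3; rewrite /W -mulrBr powR_invX -invf_div.
    apply: powR_inv_le => //; first by rewrite divr_gt0.
    have [z1 z2 z3] := step_sub s0 t1' std h1 h2 h3.
    by have [_] := hd s' t' z1 h2 z2 z3; apply.
  - move=> k' eta' Nk eta'0; have [d d0 hd'] := hVk k' eta' Nk eta'0.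
    exists d => // s' t' h1 h2 h3; have [] := step_sub s0 t1' std h1 h2 h3.
    by auto.
exists delta => // P pP lP.
pose h s t := 2 * (rho s t * expR (`|theta * x s| *+ 4)).
pose I M t := \sum_(n < M) cosn theta phi n 0 * b n 0 t.
have b00 n : b n 0 0 = 0.
  apply/eqP; rewrite -normr_le0; apply: le_trans (hb n 0 0 _ _ _ _) _ => //.
    by rewrite subrr.
  by rewrite /rho subrr powR0 ?invr_eq0 ?gt_eqF// expr0n mulr0.
have main M : (N <= M)%N -> `|psum (cosn_germ theta phi N x b) 0 P| <=
    `|I M 1| + (e0 + 2^-1 ^+ M * psum h 0 P).
  move=> NM.
  pose d s t := I M t - I M s - cosn_germ theta phi N x b s t.
  have -> : I M 1 = psum (fun s t => I M t - I M s) 0 P.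
    rewrite psum_telescope lP [X in _ - X]big1 ?subr0// => n _.
    by rewrite b00 mulr0.
  have : `|psum d 0 P| <= e0 + 2^-1 ^+ M * psum h 0 P.
    apply: le_trans (psum_le (h := fun s t => (W t - W s) * C * tau `^ (th - 1) +
      2^-1 ^+ M * h s t) _ pP) _; last first.
      rewrite /psum big_split /= -mulr_sumr; apply: lerD => //.
      rewrite -!mulr_suml -/(psum (fun s t => W t - W s) 0 P) psum_telescope lP.
      apply: (@le_trans _ _ (C * v * tau `^ (th - 1))); last first.
        exact: t2.
      apply: ler_wpM2r; first exact: powR_ge0.
      by rewrite mulrC ler_wpM2l// /W -mulrBr ler_piMl.
    rewrite lP => s t s0 st t1' std; rewrite /d /I.
    rewrite (cosn_chen_sum theta phi M chen x0 s0 st t1').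
    have rho0 : 0 <= rho s t by apply: powR_ge0.
    have WW : 0 <= W t - W s by rewrite subr_ge0 Wm.
    have Wtau : W t - W s <= tau.
      apply: le_trans etav; rewrite /W /v -mulrBr ler_wpM2l ?(ltW eta0)//.
      by apply: lerB; apply: Vm; rewrite ?(le_trans s0 st) ?(le_trans st t1').
    have G := @cosn_germ_le theta phi N K x b s t _ M NM rho0 K0 _
      (fun k => hb k s t s0 st t1' std).
    apply: (le_trans (G _)).
      rewrite mulrA; apply: (le_trans _ (le_trans t1 _)).
        apply: ler_wpM2l; first by rewrite mulr_ge0.
        by apply: ge0_ler_powR; rewrite ?nnegrE ?invr_ge0 ?(ltW q0) ?(ltW tau0).
      by rewrite ge_min lexx orbT.
    rewrite -/C lerD2r [leRHS]mulrAC [leRHS]mulrC ler_wpM2l// powR_invX -/th.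
    (* One power is kept for telescoping; the remaining exponent [th - 1] is positive and supplies
       the small factor. *)
    have -> : (W t - W s) `^ th = (W t - W s) * (W t - W s) `^ (th - 1).
      rewrite -[X in X * _](powRr1 WW) -powRD; first by rewrite [1 + _]addrC subrK.
      by rewrite [1 + _]addrC subrK gt_eqF// divr_gt0.
    rewrite ler_wpM2l//; apply: ge0_ler_powR => //; exact: ltW.
  rewrite -psum_sub; set A := psum _ 0 P; set B := psum _ 0 P.
  by move=> AB; rewrite -lerBlDl; apply: le_trans AB; rewrite distrC lerB_dist.
apply: (@le_trans _ _ e0); last by rewrite ge_min lexx.
have cv : (fun M => `|I M 1| + (e0 + 2^-1 ^+ M * psum h 0 P)) @ \oo -->
    `|0 : R| + (e0 + 0 * psum h 0 P).
  apply: cvgD; first by apply: cvg_norm.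
  apply: cvgD; first exact: cvg_cst.
  apply: cvgMl; apply: cvg_expr.
  by rewrite ger0_norm ?invr_ge0// invf_lt1// ltr1n.
rewrite normr0 mul0r addr0 add0r in cv.
apply: (cvgr_to_ge cv); near=> M; apply: main; near: M.
exact: nbhs_infty_ge.
Unshelve. all: by end_near. Qed.
End RoughSums.

(** * The logarithm on the words x^k y *)

Section LogXY.
Variable R : realType.
Implicit Types (k n M : nat) (xi eta sigma : tseries R 2).

(** The letter [0] stands for x and [1] for y. *)
Definition wx k : seq 'I_2 := nseq k 0.
Definition wxy k : seq 'I_2 := rcons (wx k) 1.

Lemma size_wxy k : size (wxy k) = k.+1.
Proof. by rewrite size_rcons size_nseq. Qed.

Lemma tone_wxy k : @tone R 2 (wxy k) = 0.
Proof. by rewrite /tone -size_eq0 size_wxy. Qed.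

Lemma tmul_wx xi eta k :
  tmul xi eta (wx k) = \sum_(j < k.+1) xi (wx j) * eta (wx (k - j)).
Proof.
rewrite /tmul size_nseq; apply: eq_bigr => j _.
by rewrite /wx take_nseq ?drop_nseq// -ltnS.
Qed.

(** A proper prefix of x^k y is a power of x and leaves a suffix of the form x^i y; the last term is
    the cut after the whole word. *)
Lemma tmul_wxy xi eta k : tmul xi eta (wxy k) =
  \sum_(j < k.+1) xi (wx j) * eta (wxy (k - j)) + xi (wxy k) * eta [::].
Proof.
rewrite /tmul size_wxy big_ord_recr /= take_oversize ?drop_oversize ?size_wxy//.
congr (_ + _); apply: eq_bigr => j _; have jk : (j <= k)%N by rewrite -ltnS.
rewrite /wxy -cats1 take_cat drop_cat size_nseq.
case: ltngtP jk => // [jk _|->].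
  by rewrite /wx take_nseq 1?ltnW// drop_nseq cats1.
by rewrite subnn take0 drop0 cats0.
Qed.

Lemma tpowS xi n : tpow xi n.+1 = tmul xi (tpow xi n).
Proof. by []. Qed.

Lemma coefM_eq (p q r : {poly R}) m : (forall i, (i < m)%N -> p`_i = q`_i) ->
  forall i, (i < m)%N -> (r * p)`_i = (r * q)`_i.
Proof.
move=> pq i im; rewrite !coefM; apply: eq_bigr => j _.
by rewrite pq// (leq_ltn_trans _ im)// leq_subr.
Qed.

Section Truncated.
Variable m : nat.

(* (e^z - 1) / z up to order m *)
Let v : {poly R} := \poly_(i < m) (i.+1`!%:R)^-1.
Let w := 'X * v.
(** Since [w] is e^z - 1 up to order [m], this is log(1 + w) / w, that is z / (e^z - 1) up to that
    order. *)
Let Q : {poly R} := \sum_(n < m.+1) ((-1) ^+ n / n.+1%:R) *: w ^+ n.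

Lemma coef_w i : w`_i = if (0 < i <= m)%N then (i`!%:R)^-1 else 0.
Proof.
by rewrite coefXM; case: i => [|i] //=; rewrite coef_poly.
Qed.

Lemma coef_wX n i : (i < n)%N -> (w ^+ n)`_i = 0.
Proof. by move=> ni; rewrite exprMn coefXnM ni. Qed.

(** The derivative of [w * Q] is a geometric series in [- w] times w', and w' = 1 + w to the order
    at hand, so the product telescopes to 1. Hence [w * Q] is z, and dividing by z gives the
    claim. *)
Lemma coef_vQ i : (i < m)%N -> (v * Q)`_i = (i == 0)%:R.
Proof.
move=> im.
have h : (w * Q)^`()`_i = (i == 0)%:R.
  have -> : (w * Q)^`() = (\sum_(n < m.+1) (- w) ^+ n) * w^`().
    rewrite /Q mulr_sumr raddf_sum mulr_suml; apply: eq_bigr => n _ /=.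
    rewrite -scalerAr -exprS derivZ deriv_exp /= -mulrnAr scalerAr mulrC.
    rewrite -[w ^+ n *+ _]scaler_nat scalerA divfK ?pnatr_eq0// [(- w) ^+ n]exprNn.
    by rewrite -[in LHS]signr_odd -[in RHS]signr_odd; case: odd;
      rewrite ?expr0 ?expr1 ?scale1r ?mul1r// scaleN1r mulN1r.
  rewrite (@coefM_eq _ (1 + w) _ m)//; last first.
    move=> j jm; rewrite coef_deriv coefD coef1 !coef_w jm /= (ltnW jm) andbT.
    case: j jm => [|j] jm /=; first by rewrite (_ : 1`! = 1%N)// invr1 mulr1n addr0.
    rewrite add0r -[LHS]mulr_natr [in LHS]factS natrM invfM mulrAC.
    by rewrite mulVf ?mul1r ?pnatr_eq0.
  have -> : (\sum_(n < m.+1) (- w) ^+ n) * (1 + w) = 1 - (- w) ^+ m.+1.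
    have := subrX1 (- w) m.+1; rewrite -[X in 1 - X](subrK 1) => ->.
    by ring.
  by rewrite coefB coef1 -mulrN exprMn coefXnM ltnS (ltnW im) subr0.
have : (w * Q)`_i.+1 = (i == 0)%:R.
  move: h; rewrite coef_deriv; case: i {im} => [|i] /=; first by rewrite mulr1n.
  by move/eqP; rewrite mulrn_eq0 /= => /eqP.
by rewrite /w -mulrA coefXM.
Qed.

Variable sigma : tseries R 2.
Hypothesis sigma_x : forall k, sigma (wx k) = (k`!%:R)^-1.
Let u := tsub sigma (@tone R 2).
Let bp : {poly R} := \poly_(i < m.+1) sigma (wxy i).

Lemma u_wx k : (k <= m)%N -> u (wx k) = w`_k.
Proof.
move=> km; rewrite coef_w km andbT /u /tsub sigma_x /tone.
by case: k {km} => [|k] /=; rewrite ?fact0 ?invr1 ?subrr ?subr0.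
Qed.

Lemma u_nil : u [::] = 0.
Proof. by rewrite /u /tsub (sigma_x 0) fact0 invr1 subrr. Qed.

(** As [u] has no constant term, y is read by the last factor of the power; each of the other [n]
    factors reads a power of x and contributes [w]. *)
Lemma tpow_wxy n k : (k <= m)%N -> tpow u n.+1 (wxy k) = (w ^+ n * bp)`_k.
Proof.
elim: n k => [|n IH] k km.
  rewrite /tpow /= tmul_wxy big1 ?add0r; last first.
    by move=> j _; rewrite tone_wxy mulr0.
  by rewrite /tone eqxx mulr1 mul1r coef_poly ltnS km /u /tsub tone_wxy subr0.
rewrite tpowS tmul_wxy [X in _ * X](_ : _ = 0) ?mulr0 ?addr0; last first.
  by rewrite tpowS /tmul big_ord1 /= u_nil mul0r.
rewrite exprS -mulrA coefM.
apply: eq_bigr => j _; have jk : (j <= k)%N by rewrite -ltnS.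
by rewrite IH ?u_wx ?(leq_trans jk)// (leq_trans (leq_subr _ _)).
Qed.

Lemma tlog_wxy k : (k <= m)%N -> tlog sigma (wxy k) = (Q * bp)`_k.
Proof.
move=> km; rewrite /tlog size_wxy big_add1 -pred_Sn.
have Qk n : (-1) ^+ n / n.+1%:R * tpow u n.+1 (wxy k) =
    ((((-1) ^+ n / n.+1%:R) *: w ^+ n) * bp)`_k.
  by rewrite tpow_wxy// -[in RHS]scalerAl coefZ.
under eq_bigr do rewrite Qk.
rewrite /Q mulr_suml coef_sum.
rewrite -(big_mkord xpredT (fun n => ((((-1) ^+ n / n.+1%:R) *: w ^+ n) * bp)`_k)).
(* [tlog] stops at the length of the word, [Q] at order [m]; the extra terms contain w^n with n > k
   and vanish in degree [k]. *)
rewrite [RHS](@big_cat_nat _ _ _ k.+1) //= [X in _ = _ + X]big1_seq ?addr0//.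
move=> n; rewrite mem_index_iota => /andP[_ /andP[kn _]].
rewrite -scalerAl coefZ coefM big1 ?mulr0// => j _.
by rewrite coef_wX ?mul0r// (leq_trans (ltn_ord j)).
Qed.

End Truncated.

(** On these words c = Q b by [tlog_wxy]; multiplying by [v], the inverse of [Q] to the order
    needed, gives b = c (e^z - 1) / z. *)
Lemma coef_wxy_log sigma k : (forall k, sigma (wx k) = (k`!%:R)^-1) ->
  sigma (wxy k) =
  \sum_(j < k.+1) (j.+1`!%:R)^-1 * tlog sigma (wxy (k - j)).
Proof.
move=> sx; pose v : {poly R} := \poly_(i < k.+1) (i.+1`!%:R)^-1.
pose Q : {poly R} := \sum_(n < k.+2) ((-1) ^+ n / n.+1%:R) *: ('X * v) ^+ n.
pose bp : {poly R} := \poly_(i < k.+2) sigma (wxy i).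
transitivity (v * (Q * bp))`_k.
  rewrite mulrA mulrC (@coefM_eq _ 1 _ k.+1)//.
    by rewrite mulr1 coef_poly ltnW.
  by move=> i ik; rewrite coef_vQ// coef1.
rewrite coefM; apply: eq_bigr => j _.
by rewrite (@tlog_wxy k.+1) ?coef_poly ?ltn_ord// (leq_trans (leq_subr _ _)).
Qed.
End LogXY.

(** * Infinite radius of convergence and vanishing of the series b *)

Section Radius.
Variable R : realType.
Implicit Types (theta phi rho : R) (b c : nat -> R) (d n k M : nat).

(** A coordinate of a pure tensor is at most the product of the Euclidean norms, so every
    decomposition satisfies the bound. The expansion in the basis shows that the infimum is over a
    nonempty set. *)
Lemma proj_norm_ge d n (xi : tensor R d n) w : `|xi w| <= proj_norm xi.
Proof.
apply: lb_le_inf.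
  pose e (v : n.-tuple 'I_d) (i : 'I_n) : 'rV[R]_d := delta_mx 0 (tnth v i).
  pose s := [seq (xi v, e v) | v <- enum {: n.-tuple 'I_d}].
  exists (\sum_(t <- s) `|t.1| * \prod_(i < n) eucl_norm (t.2 i)), s.
  split=> // v; rewrite big_map big_enum /= (bigD1 v)//= big1 ?addr0.
    rewrite ffunE big1 ?mulr1// => i _; rewrite mxE !eqxx//=.
  move=> u uv; rewrite ffunE; apply/eqP; rewrite mulf_eq0 prodf_seq_eq0.
  apply/orP; right; apply/hasP.
  have [i ui] : exists i, tnth v i != tnth u i.
    apply/existsP; apply: contraNT uv => /existsPn h; apply/eqP/eq_from_tnth => i.
    by have := h i; rewrite negbK => /eqP.
  exists i; first by rewrite mem_index_enum.
  by rewrite /= mxE eqxx (negPf ui).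
move=> _ [s [hs ->]]; rewrite hs; apply: le_trans (ler_norm_sum _ _ _) _.
apply: ler_sum => t _; rewrite normrM ffunE normr_prod; apply: ler_wpM2l => //.
apply: ler_prod => i _; rewrite normr_ge0 /= /eucl_norm -sqrtr_sqr ler_wsqrtr//.
rewrite (bigD1 (tnth w i))//= lerDl; apply: sumr_ge0 => j _; exact: sqr_ge0.
Qed.

Lemma level_norm_ge d (xi : tseries R d) (w : seq 'I_d) :
  `|xi w| <= level_norm (size w) xi.
Proof. by have := proj_norm_ge (tlevel (size w) xi) (in_tuple w); rewrite ffunE. Qed.

Lemma level_norm_ge0 n (xi : tseries R 2) : 0 <= level_norm n xi.
Proof.
apply: le_trans (normr_ge0 _) _; last first.
  have := level_norm_ge xi (nseq n 0); rewrite size_nseq; apply.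
Qed.

(** The series converges at some [r > rho], and its terms there tend to 0. *)
Lemma infinite_radius_bounded (a : R^nat) rho : 0 <= rho -> (forall n, 0 <= a n) ->
  radius_of_convergence a = +oo%E -> exists C, forall n, a n * rho ^+ n <= C.
Proof.
move=> rho0 a0 aoo.
have : (rho%:E < radius_of_convergence a)%E by rewrite aoo ltry.
move=> /ereal_sup_gt[_ [r [r0 cv] <-]]; rewrite lte_fin => rr.
have /cvgP/cvg_seq_bounded/bounded_fun_has_ubound[C hC] := cvg_series_cvg_0 cv.
exists C => n; apply: le_trans (hC (a n * r ^+ n) _); last by exists n.
by rewrite ler_wpM2l// lerXn2r ?nnegrE// ltW.
Qed.

(** Lowering the phase by [pi / 2] passes to a primitive; this is the division by z in (e^z - 1) /
    z. *)
Lemma cosn_shift theta phi n y :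
  cosn theta (phi - pi / 2) n.+1 y = theta * cosn theta phi n y.
Proof.
rewrite /cosn exprS -mulrA; congr (_ * (_ * cos (_ + _))).
by rewrite -natr1; field.
Qed.

(** Real form of b(z) = c(z) (e^z - 1) / z at a point where e^z = 1. After regrouping, each [c k]
    multiplies a Taylor remainder of a function with equal values at 0 and 1, and the decay of [c]
    makes the sum of these products tend to 0. *)
Lemma cosn_log_cvg0 theta phi b c : theta != 0 ->
  (forall t : R, cos (theta + t) = cos t) ->
  (forall k, b k = \sum_(j < k.+1) (j.+1`!%:R)^-1 * c (k - j)%N) ->
  (forall rho, 0 < rho -> exists C, forall k, `|c k| * rho ^+ k <= C) ->
  (fun M => \sum_(n < M) cosn theta phi n 0 * b n) @ \oo --> 0.
Proof.
move=> th0 per bc cbound; pose r := `|theta|; pose E := expR (r *+ 4).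
have r0 : 0 < r by rewrite normr_gt0.
have E0 : 0 <= E by apply: expR_ge0.
(* The factor 8 absorbs the 4^k coming from the remainder of order M - k + 1 and leaves 2^-k for the
   summation. *)
have [|C hC] := cbound (8 * r); first by rewrite mulr_gt0.
have sumE M : theta * (\sum_(n < M) cosn theta phi n 0 * b n) =
    \sum_(k < M) c k * (cosn_taylor theta (phi - pi / 2) (M - k).+1 k 1 -
      cosn theta (phi - pi / 2) k 1).
  transitivity (theta * \sum_(n < M) \sum_(j < n.+1)
     cosn theta phi (n - j + j) 0 * ((j.+1`!%:R)^-1 * c (n - j)%N)).
    congr (_ * _); apply: eq_bigr => n _; rewrite bc mulr_sumr.
    by apply: eq_bigr => j _; rewrite subnK// -ltnS.
  rewrite (exchange_triangle
    (fun j k => cosn theta phi (k + j) 0 * ((j.+1`!%:R)^-1 * c k))).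
  rewrite mulr_sumr; apply: eq_bigr => k _.
  (* The sum lacks the Taylor term of degree 0, the value at 0; by periodicity it is the value at
     1. *)
  have -> : cosn theta (phi - pi / 2) k 1 = cosn theta (phi - pi / 2) k 0.
    by rewrite /cosn mulr1 per mulr0 add0r.
  rewrite /cosn_taylor big_ord_recl /= addn0 expr0 fact0 divr1 mulr1 addrAC.
  rewrite subrr add0r !mulr_sumr; apply: eq_bigr => j _.
  by rewrite expr1n div1r /bump /= add1n addnS cosn_shift; ring.
have sumle M : `|\sum_(n < M) cosn theta phi n 0 * b n| <=
    2 * C * E / (4 * r) * 4^-1 ^+ M.
  rewrite -(@ler_pM2l _ r)// -normrM sumE.
  apply: le_trans (ler_norm_sum _ _ _) _.
  apply: (@le_trans _ _ (\sum_(k < M) C * E / 4 * 4^-1 ^+ M * 2^-1 ^+ k)).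
    apply: ler_sum => k _; rewrite normrM.
    apply: le_trans (ler_wpM2l _ (cosn_taylor_le _ _ _ _ _)) _ => //.
    rewrite mulr1 -/r -/E.
    have -> : (4 ^+ (M - k).+1)^-1 = 4^-1 ^+ M * 4 ^+ k / 4 :> R.
      rewrite exprS invfM mulrC; congr (_ * _).
      have -> : 4^-1 ^+ M = 4^-1 ^+ (M - k) * 4^-1 ^+ k :> R.
        by rewrite -exprD subnK// ltnW.
      rewrite -mulrA -exprMn.
      by rewrite mulVf ?pnatr_eq0// expr1n mulr1 exprVn.
    have h8 : 8 ^+ k = 4 ^+ k * 2 ^+ k :> R by rewrite -exprMn -natrM.
    have h2 : 2 ^+ k * 2^-1 ^+ k = 1 :> R.
      by rewrite -exprMn mulfV ?expr1n ?pnatr_eq0.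
    have p0 : 0 <= E * 4^-1 ^+ M / 4 * 2^-1 ^+ k.
      by rewrite !mulr_ge0 ?exprn_ge0 ?invr_ge0.
    have := ler_wpM2r p0 (hC k); rewrite exprMn h8.
    set y := 2 ^+ k in h2 *; set y' := 2^-1 ^+ k in h2 *.
    rewrite [X in X <= _ -> _](_ : _ =
      `|c k| * (r ^+ k * (E * (4^-1 ^+ M * 4 ^+ k / 4))) * (y * y')); last by field.
    rewrite h2 mulr1 [X in _ <= X -> _](_ : _ = C * E / 4 * 4^-1 ^+ M * y') //.
    by field.
  rewrite -mulr_sumr [leRHS](_ : _ = C * E / 4 * 4^-1 ^+ M * 2); last first.
    by field; rewrite gt_eqF.
  apply: ler_wpM2l; last by apply: sum_geo_half; rewrite invr_ge0 lexx ler0n.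
  have C0 : 0 <= C.
    by apply: le_trans (hC 0); rewrite mulr_ge0// exprn_ge0// mulr_ge0.
  by rewrite !mulr_ge0 ?exprn_ge0 ?invr_ge0.
apply: norm_cvg0; apply: (@squeeze_cvgr _ _ _ _ (cst 0)
    (fun M => 2 * C * E / (4 * r) * 4^-1 ^+ M)).
- by apply: nearW => M; rewrite normr_ge0 sumle.
- exact: cvg_cst.
- rewrite -(mulr0 (2 * C * E / (4 * r))); apply: cvgMr; apply: cvg_expr.
  by rewrite ger0_norm ?invr_ge0// invf_lt1// ltr1n.
Qed.
End Radius.

(** * Lie polynomials on powers of x, and coefficients of the Lyons extension *)

Section Extension.
Variable R : realType.
Implicit Types (L : tseries R 2) (k n N : nat) (w : seq 'I_2) (s t u eta : R).

(** Restricted to the words in a single letter the product is commutative, so brackets vanish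
    there. *)
Lemma lie_poly_wx L k : lie_poly L -> k != 1%N -> L (wx k) = 0.
Proof.
move=> LL k1; elim: LL => [v|a b _ a0 _ b0|c a _ a0|a b _ a0 _ b0].
- by case: k k1 => [|[|k]].
- by rewrite /tadd a0 b0 addr0.
- by rewrite /tscale a0 mulr0.
- rewrite /tsub !tmul_wx [X in _ - X](reindex_inj rev_ord_inj) /=.
  apply/eqP; rewrite subr_eq0; apply/eqP; apply: eq_bigr => j _.
  by rewrite subSS subKn 1?mulrC// -ltnS.
Qed.

Lemma tpow_lie_wx L n k : lie_poly L ->
  tpow L n (wx k) = if n == k then L (wx 1) ^+ n else 0.
Proof.
move=> LL; elim: n k => [|n IH] k.
  by rewrite /tpow /= /tone; case: k.
rewrite tpowS tmul_wx; case: k => [|k].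
  by rewrite big_ord1 lie_poly_wx// mul0r.
rewrite (bigD1 (inord 1))//= inordK// subSS subn0 IH eqSS.
rewrite big1 ?addr0; last first.
  move=> j j1; rewrite lie_poly_wx ?mul0r//; apply: contraNneq j1 => j1.
  by apply/eqP/val_inj; rewrite /= inordK.
by case: eqP => _; rewrite ?mulr0// exprS.
Qed.

Lemma texp_lie_wx L k : lie_poly L ->
  texp L (wx k) = L (wx 1) ^+ k / k`!%:R.
Proof.
move=> LL; rewrite /texp size_nseq big_mkord (bigD1 ord_max)//= tpow_lie_wx//.
rewrite eqxx mulrC big1 ?addr0// => j jk; rewrite tpow_lie_wx//.
case: eqP => // jk'; rewrite ?mulr0//; case/eqP: jk; exact: val_inj.
Qed.

Lemma powfact_addn (x y : R) n : (x + y) ^+ n / n`!%:R =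
  \sum_(j < n.+1) (x ^+ j / j`!%:R) * (y ^+ (n - j) / (n - j)`!%:R).
Proof.
rewrite addrC exprDn mulr_suml; apply: eq_bigr => j _.
have jn : (j <= n)%N by rewrite -ltnS.
rewrite -mulr_natr -(bin_fact jn) !natrM.
have h1 := fact_gt0 j; have h2 := fact_gt0 (n - j).
have h3 : (0 < 'C(n, j))%N by rewrite bin_gt0.
by field; rewrite !pnatr_eq0 -!lt0n h1 h2 h3.
Qed.

Variables (p : R) (X S : R -> R -> tseries R 2).
Hypothesis p1 : 1 <= p.
Hypothesis XS : lyons_extension p X S.

Let trunc n : mult_functional p n (fun s t => ttrunc n (S s t)).
Proof. by case: XS => _ _; apply. Qed.

Lemma extension_nil s t : 0 <= s -> s <= t -> t <= 1 -> S s t [::] = 1.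
Proof. by move=> s0 st t1; apply: (mf_one (trunc 0)). Qed.

Lemma extension_chen s t u : 0 <= s -> s <= t -> t <= u -> u <= 1 ->
  S s u = tmul (S s t) (S t u).
Proof. by case: XS => _ + _; apply. Qed.

(** Chen's relation for t, t, t and induction on the length: only the two extreme cuts survive, so
    the coefficient is twice itself. *)
Lemma extension_diag t w : 0 <= t -> t <= 1 -> w != [::] -> S t t w = 0.
Proof.
move=> t0 t1; have [n] := ubnP (size w); elim: n w => // n IH w wn w0.
have : S t t w = S t t w + S t t w.
  rewrite {1}(extension_chen t0 (lexx t) (lexx t) t1) /tmul.
  have [m wE] : exists m, size w = m.+1.
    by case: w w0 {wn} => // a v; exists (size v).
  rewrite wE big_ord_recl big_ord_recr /= take0 drop0 extension_nil// mul1r.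
  rewrite big1 ?add0r; last first.
    move=> i _; have im : (bump 0 i < size w)%N by rewrite wE ltnS ltn_ord.
    rewrite IH ?mul0r// -?size_eq0 size_take im //.
    by rewrite (leq_trans im).
  by rewrite /bump /= add1n -wE take_size drop_size extension_nil// mulr1.
by move/eqP; rewrite -subr_eq0 opprD addrA subrr sub0r oppr_eq0 => /eqP.
Qed.

Lemma level_norm_extension n s t w : size w = n ->
  `|S s t w| <= level_norm n (ttrunc n (S s t)).
Proof.
by move=> <-; have := level_norm_ge (ttrunc (size w) (S s t)) w;
  rewrite /ttrunc leqnn.
Qed.

(** A coefficient is bounded by the norm of its level, whose variation is one of the nonnegative
    terms of a finite sum. *)
Lemma extension_controlled w : w != [::] ->
  exists V, controlled (p / (size w)%:R) (fun s t => S s t w) V.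
Proof.
move=> w0; set n := size w.
have n0 : (0 < n)%N by rewrite lt0n size_eq0.
have e0 : 0 < p / n%:R by rewrite divr_gt0 ?ltr0n ?(lt_le_trans ltr01 p1).
pose T s t := ttrunc n (S s t).
have pv0 i : (0 <= level_pvar p i T)%E.
  apply: le_trans (ereal_sup_ubound _); last first.
    by exists [:: 1] => //; apply: itv_partition1; exact: ltr01.
  by rewrite lee_fin; apply: sumr_ge0 => *; exact: powR_ge0.
have pvn : (level_pvar p n T < +oo)%E.
  apply: le_lt_trans (mf_pvar (trunc n)).
  rewrite big_nat_recr//= leeDr//; apply: sume_ge0 => i _; exact: pv0.
have pvf : level_pvar p n T \is a fin_num by rewrite ge0_fin_numE.
apply: (@exists_controlled _ _ _ (fine (level_pvar p n T))) => //.
  by move=> s /andP[s0 s1]; rewrite extension_diag.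
move=> P hP; rewrite -lee_fin fineK//.
apply: le_trans (ereal_sup_ubound _); last by exists P.
rewrite lee_fin; apply: ler_sum => st _; apply: ge0_ler_powR.
- exact: ltW.
- by rewrite nnegrE.
- by rewrite nnegrE level_norm_ge0.
- exact: level_norm_extension.
Qed.

(** Continuity at the points of the diagonal, where the coefficient is 0. *)
Lemma extension_vanishing w : w != [::] -> vanishing (fun s t => S s t w).
Proof.
move=> w0; apply: vanishing_diagonal => t /andP[t0 t1] eps eps0.
set n := size w; have n0 : (0 < n)%N by rewrite lt0n size_eq0.
have /(_ n) := mf_continuous (trunc n); rewrite n0 leqnn => /(_ isT).
have st : @simplex R (t, t) by split.
move=> /(_ _ st)/cvgrPdist_lt/(_ _ eps0).
move=> /nbhs_ballP[d d0 hd]; exists d => // s u s0 su u1 sd ud.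
have /hd h : ball (t, t) d (s, u) by split; rewrite /= /ball /= distrC.
have {h} := h (And3 s0 su u1); rewrite /= sub0r normrN.
apply: le_lt_trans; apply: le_trans (ler_norm _).
have := level_norm_ge (tsub (ttrunc n (S s u)) (ttrunc n (S t t))) w.
by rewrite /tsub /ttrunc leqnn (extension_diag t0 t1 w0) subr0.
Qed.

End Extension.

(** * Smallness of the coefficients, and the words x^n *)

Section WordCoefficients.
Variable R : realType.
Implicit Types (L : tseries R 2) (k n N : nat) (w : seq 'I_2)
  (s t u eta e q : R) (V W : R -> R).

Variables (p : R) (X S : R -> R -> tseries R 2) (x : R -> R).
Hypothesis p1 : 1 <= p.
Hypothesis XS : lyons_extension p X S.
Hypothesis Xgeo : weakly_geometric p X.
Hypothesis Xx : forall s t, 0 <= s -> s <= t -> t <= 1 -> X s t (wx 1) = x t - x s.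
Let N := Num.truncn p.

Let N0 : (0 < N)%N.
Proof. by rewrite truncn_gt0. Qed.

Lemma controlled_ndecr e g V s t : controlled e g V ->
  0 <= s -> s <= t -> t <= 1 -> V s <= V t.
Proof.
move=> gV s0 st t1; rewrite -subr_ge0; apply: le_trans (gV s t s0 st t1).
exact: powR_ge0.
Qed.

Lemma extension_small w e : w != [::] -> p / (size w)%:R < e ->
  exists V, (forall s t, 0 <= s -> s <= t -> t <= 1 -> V s <= V t) /\
  forall eta, 0 < eta -> exists2 delta, 0 < delta &
    forall s t, 0 <= s -> s <= t -> t <= 1 -> t - s < delta ->
    `|S s t w| `^ e <= eta * (V t - V s).
Proof.
move=> w0 we; have [V hV] := extension_controlled p1 XS w0.
exists V; split; first by move=> s t; apply: controlled_ndecr hV.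
apply: controlled_small we hV _; last exact: (extension_vanishing XS w0).
by rewrite divr_gt0 ?(lt_le_trans ltr01 p1)// ltr0n lt0n size_eq0.
Qed.

Lemma extension_trunc s t w : 0 <= s -> s <= t -> t <= 1 ->
  (size w <= N)%N -> X s t w = S s t w.
Proof.
by move=> s0 st t1 wN; case: XS => <- // _ _; rewrite /ttrunc wN.
Qed.

(** Up to level [N] the functional is the exponential of a Lie polynomial, whose coefficient at x is
    identified by the first level. *)
Lemma extension_wx_le s t n : 0 <= s -> s <= t -> t <= 1 -> (n <= N)%N ->
  S s t (wx n) = (x t - x s) ^+ n / n`!%:R.
Proof.
move=> s0 st t1 nN; rewrite -extension_trunc ?size_nseq//.
have [L LL XL] := Xgeo (And3 s0 st t1 : simplex (s, t)).
have XE k : (k <= N)%N -> X s t (wx k) = L (wx 1) ^+ k / k`!%:R.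
  by move=> kN; rewrite XL /ttrunc size_nseq kN texp_lie_wx.
by rewrite XE// -Xx// XE// expr1 divr1.
Qed.

Lemma sum_ord_ends (F : nat -> R) k : \sum_(j < k.+2) F j =
  F 0%N + F k.+1 + \sum_(j < k) F j.+1.
Proof. by rewrite big_ord_recl big_ord_recr /= addrA addrAC. Qed.

(** Above level [N], Chen's relation, the binomial formula and induction show that the difference
    [g] of the two sides is additive. It is negligible on short intervals, hence zero. *)
Lemma extension_wx s t n : 0 <= s -> s <= t -> t <= 1 ->
  S s t (wx n) = (x t - x s) ^+ n / n`!%:R.
Proof.
have [m] := ubnP n; elim: m n s t => // m IH n s t nm s0 st t1.
have [nN|Nn] := leqP n N; first exact: extension_wx_le.
have n0 : (0 < n)%N by apply: leq_trans Nn.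
pose g s t := S s t (wx n) - (x t - x s) ^+ n / n`!%:R.
have pn : p < n%:R by apply: lt_le_trans (truncnS_gt p) _; rewrite ler_nat.
have w0 : wx n != [::] by rewrite -size_eq0 size_nseq -lt0n.
(* As n > p, the exponents 1 for x^n and n for x exceed p / n and p, so both parts of [g] are
   negligible. *)
have [|V1 [_ h1]] := @extension_small (wx n) 1 w0.
  by rewrite size_nseq ltr_pdivrMr ?ltr0n// mul1r.
have [||V2 [_ h2]] := @extension_small (wx 1) n%:R; rewrite ?divr1//.
(* Sewing with defect constant 0; the exponent 2 and [c = 2^-1] are just one admissible choice. *)
suff : `|g s t| <= 2 * 0 / (1 - 2^-1) * ((0 : R) - 0) `^ 2%:R.
  by rewrite mulr0 !mul0r normr_le0 subr_eq0 => /eqP.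
apply: (@sewing_small _ g (cst 0) (fun t => V1 t + V2 t)) => //.
- by rewrite powR_mulrn ?invr_ge0// expr2 mulrA mulfV ?mul1r.
- by rewrite invf_lt1// ltr1n.
- move=> a b c sa ab bc ct; rewrite mul0r normr_le0 /g.
  have a0 := le_trans s0 sa; have b0 := le_trans a0 ab; have c1 := le_trans ct t1.
  have b1 := le_trans bc c1.
  rewrite (extension_chen XS a0 ab bc c1) tmul_wx.
  have -> : x c - x a = (x b - x a) + (x c - x b) by ring.
  have [k nE] : exists k, n = k.+1 by case: (n) n0 => // k _; exists k.
  rewrite powfact_addn nE.
  rewrite (sum_ord_ends (fun j => S a b (wx j) * S b c (wx (k.+1 - j)))).
  rewrite (sum_ord_ends (fun j => (x b - x a) ^+ j / j`!%:R *
    ((x c - x b) ^+ (k.+1 - j) / (k.+1 - j)`!%:R))) subn0 subnn.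
  rewrite (extension_nil XS a0 ab b1) (extension_nil XS b0 bc c1) !expr0 fact0.
  rewrite divr1 mulr1 !mul1r; set A := \sum_(j < k) _; set B := \sum_(j < k) _.
  suff -> : A = B by apply/eqP; ring.
  apply: eq_bigr => j _; rewrite !IH//.
    by move: nm; rewrite ltnS; apply: leq_trans; rewrite nE subSS ltnS leq_subr.
  by move: nm; rewrite ltnS; apply: leq_trans; rewrite nE ltnS ltn_ord.
- move=> eta eta0; have [d1 d10 hd1] := h1 _ eta0; have [d2 d20 hd2] := h2 _ eta0.
  exists (Num.min d1 d2); first by rewrite lt_min d10.
  move=> a b sa ab bt; rewrite lt_min => /andP[abd1 abd2].
  have a0 := le_trans s0 sa; have b1 := le_trans bt t1.
  have := hd1 a b a0 ab b1 abd1; rewrite powRr1// => H1.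
  have := hd2 a b a0 ab b1 abd2; rewrite powR_mulrn//.
  rewrite extension_wx_le// expr1 divr1 => H2; rewrite /g.
  have : `|(x b - x a) ^+ n / n`!%:R| <= `|x b - x a| ^+ n.
    rewrite normrM normfV normrX [X in _ / X]ger0_norm//.
    rewrite ler_pdivrMr ?ltr0n ?fact_gt0//.
    by rewrite ler_peMr ?exprn_ge0// ler1n fact_gt0.
  have := ler_normB (S a b (wx n)) ((x b - x a) ^+ n / n`!%:R).
  rewrite opprD addrACA mulrDr; lra.
Qed.
End WordCoefficients.

(** * The germ of the one-form cos(theta x + phi) dy *)

Section RoughGerm.
Variable R : realType.
Implicit Types (theta phi p s t y : R) (X S : R -> R -> tseries R 2)
  (gamma : R -> 'rV[R]_2) (n k : nat).

Lemma partial_proj (h dh : R -> R) (i : 'I_2) :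
  (forall y, is_derive y 1 h (dh y)) ->
  partial i (fun v => h (v 0 0)) = fun v => if i == 0 then dh (v 0 0) else 0.
Proof.
move=> hd; apply/funext => v; rewrite /partial /derive.
have E (r : R) : (r *: delta_mx 0 i + v : 'rV[R]_2) 0 0 =
    r *: ((i == 0)%:R : R) + v 0 0.
  by rewrite !mxE eqxx /= eq_sym.
under [X in lim (X @ _)]eq_fun => r do rewrite /= E.
case: eqP => _.
  have := @derive_val _ _ _ _ _ _ _ (hd (v 0 0)); rewrite /derive => <-.
  by [].
have := @derive_val _ _ _ _ _ _ _ (is_derive_cst (h (v 0 0)) (v 0 0) (1 : R)).
move=> H; rewrite -[RHS]H /derive.
apply: (congr1 (fun f : R -> R => lim (f @ 0^'))); apply/funext => r.
by rewrite scaler0 add0r.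
Qed.

Lemma is_derive_cosn theta phi n y :
  is_derive y 1 (cosn theta phi n) (cosn theta phi n.+1 y).
Proof.
have -> : cosn theta phi n = theta ^+ n \*:
    ((fun z => cos (z + (phi + n%:R * (pi / 2)))) \o (theta \*: @idfun R)).
  by apply/funext.
have dcos z := is_derive_cosD (phi + n%:R * (pi / 2)) z.
apply: is_derive_eq.
rewrite /GRing.scale /= mulr1 /cosn exprS.
have -> : phi + n.+1%:R * (pi / 2) = phi + n%:R * (pi / 2) + pi / 2.
  by rewrite -natr1; ring.
by rewrite [LHS]mulrCA [LHS]mulrC [X in _ = X * _]mulrC.
Qed.

Lemma partials_cosn theta phi n (w : seq 'I_2) :
  partials w (fun v : 'rV[R]_2 => cosn theta phi n (v 0 0)) =
  fun v => if w == wx (size w) then cosn theta phi (n + size w) (v 0 0) else 0.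
Proof.
elim: w => [|i w IH] /=; first by rewrite addn0.
rewrite IH /wx /= eqseq_cons -/(wx (size w)).
case: (w == _); last first.
  by rewrite andbF (@partial_proj (cst 0) (cst 0)); apply/funext => v; case: ifP.
rewrite andbT (partial_proj _ (is_derive_cosn theta phi _)) addnS.
by [].
Qed.

Lemma partials_0 (w : seq 'I_2) :
  partials w (fun _ : 'rV[R]_2 => 0 : R) = fun _ => 0.
Proof.
elim: w => [|i w IH] //=; rewrite IH (@partial_proj (cst 0) (cst 0)).
by apply/funext => v; case: ifP.
Qed.

(** The form depends on x only and has only a dy component, so that only the words x^k y
    contribute. *)
Lemma rough_germ_cosn p theta phi X gamma (alpha : 'I_2 -> 'rV[R]_2 -> R) s t :
  alpha 0 = (fun _ => 0) -> alpha 1 = (fun v => cosn theta phi 0 (v 0 0)) ->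
  rough_germ p X gamma alpha s t = cosn_germ theta phi (Num.truncn p)
    (fun s => gamma s 0 0) (fun k s t => X s t (wxy k)) s t.
Proof.
move=> a0 a1; rewrite /rough_germ; apply: eq_bigr => k _.
have sk : size (wx k) == k by rewrite size_nseq.
rewrite (bigD1 (Tuple sk)) //= [X in _ + X]big1 ?addr0; last first.
  move=> w wk; rewrite big_ord_recl big_ord1.
  rewrite (_ : lift _ _ = 1); last exact: val_inj.
  rewrite a0 a1 partials_0 partials_cosn size_tuple mul0r add0r.
  by rewrite -[wx k]/(val (Tuple sk)) val_eqE (negPf wk) mul0r.
rewrite big_ord_recl big_ord1 (_ : lift _ _ = 1); last exact: val_inj.
by rewrite a0 a1 partials_0 partials_cosn size_nseq eqxx mul0r add0r.
Qed.
End RoughGerm.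

(** * Auxiliary facts on sums, moduli and periods *)

Lemma psum_eq (R : realType) (g h : R -> R -> R) s P :
  (forall u t, s <= u -> u <= t -> t <= last s P -> g u t = h u t) ->
  path <=%R s P -> psum g s P = psum h s P.
Proof.
elim: P s => [|t P IH] s gh /=; first by rewrite !psum_nil.
case/andP=> st pP; rewrite !psum_cons gh //=; last exact: le_path_last.
by congr (_ + _); apply: IH => // u r tu; apply: gh; apply: le_trans tu.
Qed.

Lemma uniform_delta (R : realType) (Q : nat -> R -> Prop) N :
  (forall k d d', d' <= d -> Q k d -> Q k d') ->
  (forall k, exists2 d, 0 < d & Q k d) ->
  exists2 d, 0 < d & forall k, (k < N)%N -> Q k d.
Proof.
move=> Qm hQ; elim: N => [|N [d d0 hd]]; first by exists 1.
have [e e0 he] := hQ N; exists (Num.min d e); first by rewrite lt_min d0.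
move=> k; rewrite ltnS leq_eqVlt => /predU1P[->|kN].
  by apply: Qm he; rewrite ge_min lexx orbT.
by apply: Qm (hd _ kN); rewrite ge_min lexx.
Qed.

Lemma cosD2piz (R : realType) (k : int) (t : R) : cos (2 * k%:~R * pi + t) = cos t.
Proof.
have h n (u : R) : cos (2 * n%:R * pi + u) = cos u.
  rewrite addrC (_ : 2 * n%:R * pi = pi *+ 2 *+ n); last first.
    by rewrite -mulr_natr -[pi *+ 2]mulr_natr; ring.
  by rewrite periodicn//; exact: cosD2pi.
case: k => n; first by rewrite -pmulrn h.
rewrite NegzE mulrNz -pmulrn -[LHS](h n.+1); congr cos.
by rewrite mulrN mulNr addNKr.
Qed.

(** * The rough integral and the conclusion *)

Section MainLemma.
Variables (R : realType) (p : R) (X S : R -> R -> tseries R 2)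
  (gamma : R -> 'rV[R]_2).
Hypothesis p1 : 1 <= p.
Hypothesis Xgeo : weakly_geometric p X.
Hypothesis Xgamma : first_level_path X gamma.
Hypothesis XS : lyons_extension p X S.
Hypothesis gamma0 : gamma 0 0 0 = 0.
Let x t := gamma t 0 0.
Let b k s t := S s t (wxy k).
Let N := Num.truncn p.

Lemma first_level_wx s t : 0 <= s -> s <= t -> t <= 1 -> X s t (wx 1) = x t - x s.
Proof. by move=> s0 st t1; apply: Xgamma. Qed.

Lemma signature_wx s t n : 0 <= s -> s <= t -> t <= 1 ->
  S s t (wx n) = (x t - x s) ^+ n / n`!%:R.
Proof. exact: (extension_wx p1 XS Xgeo first_level_wx). Qed.

Let extension_chen_xy : chen_xy x b.
Proof.
move=> k s t u s0 st tu u1; rewrite /b (extension_chen XS s0 st tu u1) tmul_wxy.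
rewrite (extension_nil XS (le_trans s0 st) tu u1) mulr1 addrC; congr (_ + _).
by apply: eq_bigr => j _; rewrite signature_wx// (le_trans tu).
Qed.

Lemma rough_integral_cosn theta phi (alpha : 'I_2 -> 'rV[R]_2 -> R) :
  alpha 0 = (fun _ => 0) -> alpha 1 = (fun v => cosn theta phi 0 (v 0 0)) ->
  (fun M => \sum_(n < M) cosn theta phi n 0 * b n 0 1) @ \oo --> 0 ->
  is_rough_integral p X gamma alpha 0.
Proof.
move=> a0 a1 lim eps eps0; pose q := (p + N.+1%:R) / 2.
have pN : p < N.+1%:R by apply: truncnS_gt.
have q0 : 0 < q by rewrite divr_gt0// addr_gt0// (lt_le_trans ltr01).
have [pq qN] := midf_lt pN.
have wxy0 k : wxy k != [::] by rewrite -size_eq0 size_wxy.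
have [//||Vx [Vxm hx]] := extension_small p1 XS (w := wx 1) (e := q).
  by rewrite divr1.
have hb k : exists V, (forall s t, 0 <= s -> s <= t -> t <= 1 -> V s <= V t) /\
  forall eta, 0 < eta -> exists2 delta, 0 < delta &
    forall s t, 0 <= s -> s <= t -> t <= 1 -> t - s < delta ->
    `|b k s t| `^ (q / k.+1%:R) <= eta * (V t - V s).
  apply: (extension_small p1 XS (wxy0 k)).
  by rewrite size_wxy ltr_pM2r ?invr_gt0.
have [Vb hVb] := choice hb.
have hc k : exists V, (N <= k)%N -> forall eta, 0 < eta -> exists2 delta, 0 < delta &
    forall s t, 0 <= s -> s <= t -> t <= 1 -> t - s < delta ->
    `|b k s t| <= eta * (V t - V s).
  have [Nk|_] := leqP N k; last by exists (cst 0).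
  have [//||V [_ hV]] := extension_small p1 XS (w := wxy k) (e := 1).
    rewrite size_wxy ltr_pdivrMr ?ltr0n// mul1r (lt_le_trans pN)//.
    by rewrite ler_nat.
  exists V => _ eta /hV[d d0 hd]; exists d => // s t s0 st t1 std.
  by have := hd s t s0 st t1 std; rewrite powRr1.
have [Vc hVc] := choice hc.
(* A single function dominates x and the finitely many words below level [N]; the higher words keep
   separate functions. *)
pose V t := Vx t + \sum_(k < N) Vb k t.
have VE s t : V t - V s = (Vx t - Vx s) + \sum_(k < N) (Vb k t - Vb k s).
  by rewrite sumrB /V; ring.
have Vbge k s t : 0 <= s -> s <= t -> t <= 1 -> 0 <= Vb k t - Vb k s.
  by move=> *; rewrite subr_ge0; apply: (hVb k).1.
have sum0 s t : 0 <= s -> s <= t -> t <= 1 ->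
    0 <= \sum_(k < N) (Vb k t - Vb k s).
  by move=> *; apply: sumr_ge0 => k _; apply: Vbge.
have [||||delta delta0 hd] := @cosn_germ_sum R theta phi q N x b V Vc q0 qN
    extension_chen_xy gamma0 _ _ _ lim (eps / 2).
- move=> s t s0 st t1; rewrite -subr_ge0 VE addr_ge0 ?sum0// subr_ge0.
  exact: Vxm.
- move=> eta eta0; have [d1 d10 hd1] := hx _ eta0.
  pose Q k d := forall s t, 0 <= s -> s <= t -> t <= 1 -> t - s < d ->
    `|b k s t| `^ (q / k.+1%:R) <= eta * (Vb k t - Vb k s).
  have [||d2 d20 hd2] := @uniform_delta R Q N.
  + move=> k d d' dd' h s t s0 st t1 std; apply: h => //.
    exact: lt_le_trans dd'.
  + by move=> k; apply: (hVb k).2.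
  exists (Num.min d1 d2); first by rewrite lt_min d10.
  move=> s t s0 st t1; rewrite lt_min => /andP[sd1 sd2]; split.
    have := hd1 s t s0 st t1 sd1; rewrite signature_wx// expr1 divr1 => h.
    by apply: le_trans h _; rewrite ler_wpM2l ?(ltW eta0)// VE lerDl sum0.
  move=> k kN; apply: le_trans (hd2 k kN s t s0 st t1 sd2) _.
  rewrite ler_wpM2l ?(ltW eta0)// VE (bigD1 (Ordinal kN))//= addrCA lerDl.
  by rewrite addr_ge0 ?subr_ge0 ?Vxm// sumr_ge0// => j _; apply: Vbge.
- by move=> k eta Nk; apply: hVc.
- by rewrite divr_gt0.
exists delta => // P [lP /eqP eP] mesh; rewrite subr0.
have leP : path <=%R 0 P by apply: sub_path lP => ? ? /ltW.
have -> : \sum_(st <- intervals P) rough_germ p X gamma alpha st.1 st.2 =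
    psum (cosn_germ theta phi N x b) 0 P.
  apply: (@psum_eq _ (rough_germ p X gamma alpha)) => // s t s0 st.
  rewrite eP => t1; rewrite (@rough_germ_cosn R p theta phi X gamma alpha s t a0 a1).
  apply: eq_bigr => k _; rewrite (extension_trunc XS)// size_wxy.
  exact: ltn_ord.
apply: le_lt_trans (hd P _ eP) _; last by rewrite ltr_pdivrMr// ltr_pMr// ltr1n.
move: mesh; rewrite /intervals; elim: P 0 lP {eP leP} => // t P IH s /=.
case/andP=> st pP mesh; rewrite IH// ?andbT.
  by rewrite /step ltW//=; apply: (mesh (s, t)); rewrite inE eqxx.
by move=> u uP; apply: mesh; rewrite inE uP orbT.
Qed.
End MainLemma.

Theorem theorem3p1 (R : realType) (p : R) (X : R -> R -> tseries R 2)
    (gamma : R -> 'rV[R]_2) (sigma : tseries R 2) :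
  rough_path p X -> weakly_geometric p X -> first_level_path X gamma ->
  is_signature p X sigma ->
  gamma 0 0 0 = 0 -> gamma 0 0 1 = 0 -> gamma 1 0 0 = 1 ->
  tseries_radius (tlog sigma) = +oo%E ->
  forall k : int, k != 0 ->
    is_rough_integralC p X gamma
      (form_dy (fun x => expi (2 * k%:~R * pi * x))) 0.
Proof.
move=> [p1 _] Xgeo Xgamma [S XS ->] gamma0 _ gamma1 radius k k0.
pose theta : R := 2 * k%:~R * pi.
have theta0 : theta != 0.
  by rewrite !mulf_neq0 ?intr_eq0 ?pnatr_eq0// gt_eqF// pi_gt0.
have sx n : S 0 1 (wx n) = (n`!%:R)^-1.
  rewrite (signature_wx p1 Xgeo Xgamma XS)// gamma0 gamma1 subr0 expr1n.
  by rewrite div1r.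
have decay rho : 0 < rho ->
    exists C, forall j, `|tlog (S 0 1) (wxy j)| * rho ^+ j <= C.
  move=> rho0; have [|C hC] := infinite_radius_bounded (ltW rho0) _ radius.
    by move=> n; apply: level_norm_ge0.
  (* The word x^j y lies on level j + 1, hence the division by [rho]. *)
  exists (C / rho) => j; rewrite ler_pdivlMr// -mulrA -exprSr.
  apply: le_trans (hC j.+1); rewrite ler_wpM2r ?exprn_ge0 ?(ltW rho0)//.
  by have := level_norm_ge (tlog (S 0 1)) (wxy j); rewrite size_wxy.
have lim phi :
    (fun M => \sum_(n < M) cosn theta phi n 0 * S 0 1 (wxy n)) @ \oo --> 0.
  apply: (@cosn_log_cvg0 _ _ phi (fun n => S 0 1 (wxy n)) _ theta0
    (cosD2piz k) _ decay).
  by move=> j; apply: coef_wxy_log.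
(* Real and imaginary parts are the phases 0 and [- (pi / 2)]. *)
split.
  apply: (rough_integral_cosn p1 Xgeo Xgamma XS gamma0 _ _ (lim 0)) => //.
  by apply/funext => v; rewrite /cosn expr0 mul1r mul0r !addr0.
apply: (rough_integral_cosn p1 Xgeo Xgamma XS gamma0 _ _ (lim (- (pi / 2)))) => //.
by apply/funext => v; rewrite /cosn expr0 mul1r mul0r addr0 cosBpihalf.
Qed.
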